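(* (1) Let $q$ be a $2$-elementary quadratic form. Let $q'$ denote an even $2$-elementary quadratic form (possibly zero), $b_{q'}$ its associated bilinear form, and let $\varepsilon\in\{1,3\}$. (a) If $q\cong\mathbf u^{\oplus m}$ with $m\ge 1$, then $\#O(q)=2^{m(m-1)+1}(2^m-1)\prod_{k=1}^{m-1}(2^{2k}-1)$ and $\#q^{-1}(\{0\})=2^{m-1}(2^m+1)$. (b) If $q\cong\mathbf u^{\oplus m-1}\oplus\mathbf v$ with $m\ge 1$, then $\#O(q)=2^{m(m-1)+1}(2^m+1)\prod_{k=1}^{m-1}(2^{2k}-1)$ and $\#q^{-1}(\{0\})=2^{m-1}(2^m-1)$. (c) If $q\cong q'\oplus\mathbf w^{\varepsilon}$, then $\#O(q)=\#O(q')$ and $\#q^{-1}(\{0\})=\#q'^{-1}(\{0\})$. (d) If $q\cong q'\oplus\mathbf w^{\varepsilon}\oplus\mathbf w^{\varepsilon}$, then $\#O(q)=2\,\#O(b_{q'})$ and $\#q^{-1}(\{0\})=2^{\dim q'}$. (e) If $q\cong q'\oplus\mathbf w^{1}\oplus\mathbf w^{3}$, then $\#O(q)=2^{\dim q'}\,\#O(q')$ and $\#q^{-1}(\{0\})=2\,\#q'^{-1}(\{0\})$. (2) Let $b$ be a $2$-elementary symmetric bilinear form and $m\ge 0$. (a) If $b\cong\bar{\mathbf u}^{\oplus m}$, then $\#O(b)=2^{m^2}\prod_{k=1}^m(2^{2k}-1)$. (b) If $b\cong\bar{\mathbf u}^{\oplus m}\oplus\bar{\mathbf w}$, then $\#O(b)=\#O(\bar{\mathbf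 u}^{\oplus m})$. (c) If $b\cong\bar{\mathbf u}^{\oplus m}\oplus\bar{\mathbf w}^{\oplus 2}$, then $\#O(b)=2^{2m+1}\,\#O(\bar{\mathbf u}^{\oplus m})$. (3) Let $p\ne 2$ be a prime and $q$ a $p$-elementary quadratic form. (a) If $q$ is hyperbolic of dimension $2m$ with $m\ge1$, then $\#O(q)=2p^{m(m-1)}(p^m-1)\prod_{k=1}^{m-1}(p^{2k}-1)$. (b) If $q$ has dimension $2m$ and is not hyperbolic, then $\#O(q)=2p^{m(m-1)}(p^m+1)\prod_{k=1}^{m-1}(p^{2k}-1)$. (c) If $q$ has dimension $2m+1$, then $\#O(q)=2p^{m^2}\prod_{k=1}^m(p^{2k}-1)$.
   Context: Let $p$ be a prime and $V=(\mathbb{Z}/p\mathbb{Z})^a$, $a\ge0$. A $p$-elementary symmetric bilinear form is a non-degenerate symmetric biadditive map $b:V\times V\to\mathbb{Q}/p\mathbb{Z}$ (it automatically takes values in $\mathbb{Z}/p\mathbb{Z}$). A $p$-elementary quadratic form is a map $q:V\to\mathbb{Q}/p\mathbb{Z}$ with $q(nx)=n^2q(x)$ for all $n\in\mathbb{Z}$, $x\in V$, such that $b(x,y)=q(x+y)-q(x)-q(y)$ is a $p$-elementary symmetric bilinear form, called the associated bilinear form. Non-degenerate means that for each $x\neq 0$ there is $y$ with $b(x,y)\ne 0$. The dimension of $q$ is $a$. $O(q)$, $O(b)$ are the groups of linear automorphisms of $V$ preserving $q$, respectively $b$; $\cong$ denotes isometry and $\oplus$ orthogonal direct sum. For $p=2$: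 $\mathbf u$ and $\mathbf v$ are the $2$-elementary quadratic forms on $(\mathbb{Z}/2\mathbb{Z})^2$ with generators $x,y$ given by $q(ax+by)=ab$ and $q(ax+by)=a^2+ab+b^2$, respectively; $\bar{\mathbf u}$ denotes the bilinear form associated to $\mathbf u$. $\mathbf w^1,\mathbf w^3$ are the $2$-elementary quadratic forms on $\mathbb{Z}/2\mathbb{Z}$ with generator $x$ given by $q(x)=\frac12$ and $q(x)=\frac32$, respectively; their associated bilinear forms are isomorphic and denoted $\bar{\mathbf w}$. A $2$-elementary quadratic form is even if its associated bilinear form is alternating, equivalently if it is isomorphic to $\mathbf u^{\oplus m}$ ($m\geq 0$) or $\mathbf u^{\oplus m-1}\oplus\mathbf v$ ($m\ge1$). For $p\neq2$: $\mathbf h$ is the $p$-elementary quadratic form on $(\mathbb{Z}/p\mathbb{Z})^2$ with generators $x,y$ given by $q(ax+by)=ab$; a $p$-elementary quadratic form is hyperbolic if it is isomorphic to $\mathbf h^{\oplus m}$ for some $m$. *)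

(* Defs.v *)
From HB Require Import structures.
From mathcomp Require Import all_boot all_order all_fingroup all_algebra.
From mathcomp Require Import ring.

Set Implicit Arguments.
Unset Strict Implicit.
Unset Printing Implicit Defensive.

Import Order.TTheory GRing.Theory Num.Theory.
Local Open Scope ring_scope.
Local Open Scope quotient_scope.

Definition pZ (p : nat) : {pred rat} := [pred x | x / p%:R \is a Num.int].

Fact pZ_zmod_closed p : zmod_closed (pZ p).
Proof.
split=> [|x y]; rewrite !inE ?mul0r ?rpred0 //.
by rewrite mulrBl => xZ yZ; rewrite rpredB.
Qed.

HB.instance Definition _ p := GRing.isZmodClosed.Build rat (pZ p) (pZ_zmod_closed p).

Definition QmodZ (p : nat) : zmodType := Quotient.quot (pZ p).

Definition toQmodZ (p : nat) (r : rat) : QmodZ p := \pi_(Quotient.quot (pZ p)) r.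

(* ['F_p] is Z/pZ only when [p] is prime; every statement below about a
   variable [p] is meant under that hypothesis. *)

Section Forms.
Variables (p n : nat).
Local Notation V := 'rV['F_p]_n.

Definition bilinear_form (b : V -> V -> QmodZ p) : Prop :=
  [/\ forall x y, b x y = b y x,
      forall x, {morph b x : y z / y + z},
      forall y, {morph b^~ y : x z / x + z}
    & forall x, x != 0 -> exists y, b x y != 0].

Definition associated (q : V -> QmodZ p) (x y : V) : QmodZ p :=
  q (x + y) - q x - q y.

Definition quadratic_form (q : V -> QmodZ p) : Prop :=
  (forall (k : int) (x : V), q (x *~ k) = q x *~ (k ^+ 2))
  /\ bilinear_form (associated q).

Definition even_form (q : V -> QmodZ p) : Prop :=
  quadratic_form q /\ forall x, associated q x x = 0.

Definition zero_set (q : V -> QmodZ p) : {set V} := [set x | q x == 0].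

Definition linear_aut : {set {perm V}} :=
  [set f : {perm V} |
     [forall a : 'F_p, forall x : V, forall y : V,
        f (a *: x + y) == a *: f x + f y]].

Definition Oq (q : V -> QmodZ p) : {set {perm V}} :=
  [set f in linear_aut | [forall x : V, q (f x) == q x]].

Definition Ob (b : V -> V -> QmodZ p) : {set {perm V}} :=
  [set f in linear_aut |
     [forall x : V, forall y : V, b (f x) (f y) == b x y]].

Lemma linear_autP (f : {perm V}) : reflect (linear f) (f \in linear_aut).
Proof.
rewrite inE; apply: (iffP forallP) => [h a x y|h a].
  by have /forallP/(_ x)/forallP/(_ y)/eqP := h a.
by apply/forallP => x; apply/forallP => y; apply/eqP/h.
Qed.

Fact linear_aut_group_set : group_set linear_aut.
Proof.
apply/group_setP; split=> [|f g /linear_autP lf /linear_autP lg].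
  by apply/linear_autP => a x y; rewrite !perm1.
by apply/linear_autP => a x y; rewrite !permM lf lg.
Qed.
Canonical linear_aut_group := Group linear_aut_group_set.

Lemma OqP q (f : {perm V}) :
  reflect (linear f /\ forall x, q (f x) = q x) (f \in Oq q).
Proof.
rewrite inE; apply: (iffP andP) => -[/linear_autP lf].
  by move/forallP=> qf; split=> // x; apply/eqP.
by move=> qf; split=> //; apply/forallP => x; apply/eqP.
Qed.

Lemma ObP b (f : {perm V}) :
  reflect (linear f /\ forall x y, b (f x) (f y) = b x y) (f \in Ob b).
Proof.
rewrite inE; apply: (iffP andP) => -[/linear_autP lf].
  by move/forallP=> bf; split=> // x y; apply/eqP/(forallP (bf x)).
by move=> bf; split=> //; apply/forallP => x; apply/forallP => y; apply/eqP.
Qed.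

Fact Oq_group_set q : group_set (Oq q).
Proof.
apply/group_setP; split=> [|f g /OqP[lf qf] /OqP[lg qg]]; apply/OqP.
  by split=> [a x y|x]; rewrite !perm1.
by split=> [a x y|x]; rewrite !permM ?qg // lf lg.
Qed.
Canonical Oq_group q := Group (Oq_group_set q).

Fact Ob_group_set b : group_set (Ob b).
Proof.
apply/group_setP; split=> [|f g /ObP[lf bf] /ObP[lg bg]]; apply/ObP.
  by split=> [a x y|x y]; rewrite !perm1.
by split=> [a x y|x y]; rewrite !permM ?bg // lf lg.
Qed.
Canonical Ob_group b := Group (Ob_group_set b).

End Forms.

Definition isometric_q p n1 n2 (q1 : 'rV['F_p]_n1 -> QmodZ p)
    (q2 : 'rV['F_p]_n2 -> QmodZ p) : Prop :=
  exists f : {linear 'rV['F_p]_n1 -> 'rV['F_p]_n2},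
    bijective f /\ forall x, q2 (f x) = q1 x.

Definition isometric_b p n1 n2
    (b1 : 'rV['F_p]_n1 -> 'rV['F_p]_n1 -> QmodZ p)
    (b2 : 'rV['F_p]_n2 -> 'rV['F_p]_n2 -> QmodZ p) : Prop :=
  exists f : {linear 'rV['F_p]_n1 -> 'rV['F_p]_n2},
    bijective f /\ forall x y, b2 (f x) (f y) = b1 x y.

Definition sum_q p n1 n2 (q1 : 'rV['F_p]_n1 -> QmodZ p)
    (q2 : 'rV['F_p]_n2 -> QmodZ p) : 'rV['F_p]_(n1 + n2) -> QmodZ p :=
  fun x => q1 (lsubmx x) + q2 (rsubmx x).

Definition sum_b p n1 n2
    (b1 : 'rV['F_p]_n1 -> 'rV['F_p]_n1 -> QmodZ p)
    (b2 : 'rV['F_p]_n2 -> 'rV['F_p]_n2 -> QmodZ p) :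
    'rV['F_p]_(n1 + n2) -> 'rV['F_p]_(n1 + n2) -> QmodZ p :=
  fun x y => b1 (lsubmx x) (lsubmx y) + b2 (rsubmx x) (rsubmx y).

(* The recursive calls typecheck because [m.+1 * n] and [n + m * n] are
   convertible. *)
Fixpoint multiple_q p n (q : 'rV['F_p]_n -> QmodZ p) (m : nat) :
    'rV['F_p]_(m * n) -> QmodZ p :=
  match m with
  | 0 => fun _ => 0
  | m'.+1 => sum_q q (@multiple_q _ _ q m')
  end.

Fixpoint multiple_b p n (b : 'rV['F_p]_n -> 'rV['F_p]_n -> QmodZ p)
    (m : nat) : 'rV['F_p]_(m * n) -> 'rV['F_p]_(m * n) -> QmodZ p :=
  match m with
  | 0 => fun _ _ => 0
  | m'.+1 => sum_b b (@multiple_b _ _ b m')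
  end.

Arguments multiple_q {p n} q m x.
Arguments multiple_b {p n} b m x y.

(* Each standard form is given by its value on the representatives in
    [0, p-1] of the coordinates; the lemmas after the definitions give the value
    for arbitrary integer coefficients. *)

Definition coord_rat p n (x : 'rV['F_p]_n) (i : 'I_n) : rat := (x 0 i : nat)%:R.

Definition h_form p (x : 'rV['F_p]_2) : QmodZ p :=
  toQmodZ p (coord_rat x 0 * coord_rat x 1).

Definition u_form : 'rV['F_2]_2 -> QmodZ 2 := @h_form 2.

Definition v_form (x : 'rV['F_2]_2) : QmodZ 2 :=
  toQmodZ 2 (coord_rat x 0 ^+ 2 + coord_rat x 0 * coord_rat x 1 + coord_rat x 1 ^+ 2).

Definition w_form (e : nat) (x : 'rV['F_2]_1) : QmodZ 2 :=
  toQmodZ 2 (e%:R / 2%:R * coord_rat x 0 ^+ 2).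

Definition u_bar : 'rV['F_2]_2 -> 'rV['F_2]_2 -> QmodZ 2 := associated u_form.

(* [w_form 3] has an isometric associated form. *)
Definition w_bar : 'rV['F_2]_1 -> 'rV['F_2]_1 -> QmodZ 2 :=
  associated (w_form 1).

Definition hyperbolic p n (q : 'rV['F_p]_n -> QmodZ p) : Prop :=
  exists m : nat, isometric_q q (multiple_q (@h_form p) m).

Lemma eq_toQmodZ p (r s : rat) :
  (toQmodZ p r == toQmodZ p s) = ((r - s) / p%:R \is a Num.int).
Proof. by rewrite -[RHS]/(r - s \in pZ p) Quotient.idealrBE. Qed.

Lemma coord_ratE p n (x : 'rV['F_p]_n) (i : 'I_n) (a : int) : prime p ->
  x 0 i = a%:~R -> exists k : int, coord_rat x i = a%:~R + k%:~R * p%:R.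
Proof.
move=> p_pr xa; set c : int := (x 0 i : nat)%:Z.
have /eqP : ((c - a)%:~R : 'F_p) = 0.
  by rewrite rmorphB /= -xa -pmulrn natr_Zp subrr.
rewrite -(dvdz_pcharf (pchar_Fp p_pr)) => /dvdzP[k ck]; exists k.
have -> : coord_rat x i = c%:~R by [].
by rewrite -(subrK a c) ck rmorphD rmorphM /= addrC.
Qed.

Lemma h_formE p (x : 'rV['F_p]_2) (a b : int) : prime p ->
  x 0 0 = a%:~R -> x 0 1 = b%:~R -> h_form x = toQmodZ p (a%:~R * b%:~R).
Proof.
move=> p_pr /(coord_ratE p_pr)[k xa] /(coord_ratE p_pr)[l xb].
apply/eqP; rewrite eq_toQmodZ xa xb.
have p0 : p%:R != 0 :> rat by rewrite pnatr_eq0 -lt0n prime_gt0.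
have -> : ((a%:~R + k%:~R * p%:R) * (b%:~R + l%:~R * p%:R) - a%:~R * b%:~R)
    / p%:R = (a * l + k * b + k * l * p%:Z)%:~R :> rat by field.
exact: intr_int.
Qed.

Lemma v_formE (x : 'rV['F_2]_2) (a b : int) :
  x 0 0 = a%:~R -> x 0 1 = b%:~R ->
  v_form x = toQmodZ 2 (a%:~R ^+ 2 + a%:~R * b%:~R + b%:~R ^+ 2).
Proof.
move=> /(coord_ratE (isT : prime 2))[k xa] /(coord_ratE (isT : prime 2))[l xb].
apply/eqP; rewrite eq_toQmodZ xa xb.
set A : rat := a%:~R; set B : rat := b%:~R.
set K : rat := k%:~R; set L : rat := l%:~R.
have -> : ((A + K * 2%:R) ^+ 2 + (A + K * 2%:R) * (B + L * 2%:R)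
     + (B + L * 2%:R) ^+ 2 - (A ^+ 2 + A * B + B ^+ 2)) / 2%:R
  = (2 * a * k + 2 * k ^+ 2 + a * l + k * b + 2 * k * l + 2 * b * l
     + 2 * l ^+ 2)%:~R by rewrite /A /B /K /L; field.
exact: intr_int.
Qed.

Lemma w_formE e (x : 'rV['F_2]_1) (a : int) :
  x 0 0 = a%:~R -> w_form e x = toQmodZ 2 (e%:R / 2%:R * a%:~R ^+ 2).
Proof.
move=> /(coord_ratE (isT : prime 2))[k xa].
apply/eqP; rewrite eq_toQmodZ xa.
have -> : (e%:R / 2%:R * (a%:~R + k%:~R * 2%:R) ^+ 2
     - e%:R / 2%:R * a%:~R ^+ 2) / 2%:R
  = (e%:Z * (a * k + k ^+ 2))%:~R :> rat by field.
exact: intr_int.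
Qed.

(* Main.v *)
From HB Require Import structures.
Require Import Defs.
From mathcomp Require Import all_boot all_order all_fingroup all_algebra.
From mathcomp Require Import ring zify.

(** Every order is obtained by the orbit-stabiliser theorem, splitting off one
    hyperbolic plane at a time, over an arbitrary finite field with [q] elements.

    Let [Q] be a nondegenerate quadratic form and [e], [f] a hyperbolic pair.
    The isometry group is transitive on nonzero singular vectors, by reflections
    ([singular_trans]), and the stabiliser of [e] is transitive on the singular
    [y] with [B e y = 1], by Siegel transformations ([hyperbolic_trans]). The
    stabiliser of the pair is the isometry group of its orthogonal complement.
    So the order of the group of [h + Q'] is that of [Q'] times
    [(number of zeros - 1) * q ^ (dim Q')] ([card_orth_hyp]), and the number of
    zeros obeys a linear recursion ([card_zeros_hyp]). This argument does not
    distinguish characteristic 2.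

    Splitting stops at an anisotropic form, of dimension at most 2
    ([witt_decomposition]), whose group has order 1, 2 or [2 * (q + 1)] in
    dimension 0, 1 or 2. In the last case the vectors with a given nonzero value
    form an orbit, because the reflection in [x - y] is available whenever
    [x <> y] ([card_orth_aniso_plane]). Multiplying the factors gives the
    formulas for [p] odd and for even forms when [p = 2]; in particular only the
    dimension of the anisotropic part matters, and in even dimension it is 0
    exactly in the hyperbolic case. The same scheme with transvections gives the
    symplectic groups ([card_symplectic]).

    The other forms for [p = 2] are sums of an even or alternating form on [V0]
    and of one or two lines. Their bilinear form has a characteristic vector
    [c], defined by [b x x = b x c] and fixed by all isometries. With one line,
    [c] spans the line and its orthogonal [V0] is preserved
    ([card_isoms_line]). With two, let [d] span the first line: an isometry
    fixing [d] is an isometry of [V0], so the order is that of [V0] times the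
    length of the orbit of [d] ([card_isoms_plane]). That orbit consists of the
    [v + d + mu c] with the same value as [d], which explicit shears reach
    ([card_isoms_dot2], [card_orth_w11], [card_orth_w13]). It has [2 ^ (n + 1)]
    elements for the bilinear form; [2 ^ n], one for each [v], when [c] is
    singular; and two for each zero [v] of the even form when [c] is not. In the
    last case the product of the number of zeros and of the order of the
    orthogonal group is the order of the symplectic group
    ([card_isoms_polar]). *)

Set Implicit Arguments.
Unset Strict Implicit.
Unset Printing Implicit Defensive.

Import Order.TTheory GRing.Theory Num.Theory.
Local Open Scope ring_scope.

(** * Products of orders *)

Section Arithmetic.
Local Open Scope nat_scope.

Lemma sqr_minus1 q m : (q ^ m - 1) * (q ^ m + 1) = q ^ (2 * m) - 1.
Proof. by rewrite mulnC expnM -[1 in RHS](exp1n 2) expnAC subn_sqr mulnC. Qed.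

(** The three products met below collapse because [q ^ i - 1] meets
    [q ^ i + 1] in the next factor, in the same factor, or in the previous one,
    according to the dimension 0, 1 or 2 of the anisotropic part. *)
Lemma prod_orders0 q m : 0 < m ->
  \prod_(1 <= i < m.+1) ((q ^ i - 1) * (q ^ (i + 0).-1 + 1) * q ^ (i.-1 * 2 + 0))
  = 2 * q ^ (m * (m - 1)) * (q ^ m - 1) * \prod_(1 <= k < m) (q ^ (2 * k) - 1).
Proof.
case: m => // m _; elim: m => [|m IH].
  by rewrite big_nat1 big_geq //= !expn0 expn1; ring.
rewrite big_nat_recr //= IH [in RHS]big_nat_recr //= -sqr_minus1.
have -> : m.+2 * (m.+2 - 1) = m.+1 * (m.+1 - 1) + (m.+1 * 2 + 0).
  by rewrite !subSS !subn0; nia.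
by rewrite !addn0 expnD /=; ring.
Qed.

Lemma prod_orders1 q m :
  \prod_(1 <= i < m.+1) ((q ^ i - 1) * (q ^ (i + 1).-1 + 1) * q ^ (i.-1 * 2 + 1))
  = q ^ (m ^ 2) * \prod_(1 <= k < m.+1) (q ^ (2 * k) - 1).
Proof.
elim: m => [|m IH]; first by rewrite !big_geq.
rewrite big_nat_recr //= IH [in RHS]big_nat_recr //= -sqr_minus1 (addn1 m).
have -> : m.+1 ^ 2 = m ^ 2 + (m * 2 + 1) by rewrite -!mulnn; ring.
by rewrite !expnD; ring.
Qed.

Lemma prod_orders2 q m :
  (q + 1) * \prod_(1 <= i < m.+1)
     ((q ^ i - 1) * (q ^ (i + 2).-1 + 1) * q ^ (i.-1 * 2 + 2))
  = q ^ (m.+1 * m) * (q ^ m.+1 + 1) * \prod_(1 <= k < m.+1) (q ^ (2 * k) - 1).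
Proof.
elim: m => [|m IH]; first by rewrite !big_geq //= expn1 muln0 expn0; ring.
rewrite big_nat_recr //= mulnA IH [in RHS]big_nat_recr //= -sqr_minus1 (addn2 m).
have -> : m.+2 * m.+1 = m.+1 * m + (m * 2 + 2) by ring.
by rewrite !expnD; ring.
Qed.

Lemma zeros_plus m : 0 < m ->
  ((2 ^ m - 1) * (2 ^ (m + 0).-1 + 1)).+1 = 2 ^ (m - 1) * (2 ^ m + 1).
Proof.
case: m => // m _; rewrite addn0 [(m.+1 - 1)%N]subn1 /= expnS.
have := expn_gt0 2 m; case: (2 ^ m) => // M _.
by rewrite (_ : 2 * M.+1 - 1 = 2 * M + 1); [ring|lia].
Qed.

Lemma zeros_minus m :
  ((2 ^ m - 1) * (2 ^ (m + 2).-1 + 1)).+1 = 2 ^ m * (2 ^ m.+1 - 1).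
Proof.
rewrite addn2 /= expnS; have := expn_gt0 2 m; case: (2 ^ m) => // M _.
by rewrite subn1 /= (_ : 2 * M.+1 - 1 = 2 * M + 1); [ring|lia].
Qed.

End Arithmetic.

(** * Isometries *)

Section Isometries.
Variable F : finFieldType.

Section Group.
Variables (T : eqType) (n : nat) (s : 'rV[F]_n -> 'rV[F]_n -> T).

(** The structure [s] stands for a bilinear form as well as for a quadratic
    form, seen as a function that ignores its second argument. *)
Definition isoms : {set {perm 'rV[F]_n}} :=
  [set f : {perm 'rV[F]_n} |
     [forall a : F, forall x, forall y, f (a *: x + y) == a *: f x + f y]
     && [forall x, forall y, s (f x) (f y) == s x y]].

Lemma isomsP (f : {perm 'rV[F]_n}) :
  reflect (linear f /\ forall x y, s (f x) (f y) = s x y) (f \in isoms).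
Proof.
rewrite inE; apply: (iffP andP) => -[lf sf]; split.
- by move=> a x y; apply/eqP/(forallP (forallP (forallP lf a) x)).
- by move=> x y; apply/eqP/(forallP (forallP sf x)).
- by apply/forallP=> a; apply/forallP=> x; apply/forallP=> y; apply/eqP/lf.
- by apply/forallP=> x; apply/forallP=> y; apply/eqP/sf.
Qed.

Fact isoms_group_set : group_set isoms.
Proof.
apply/group_setP; split=> [|f g /isomsP[lf sf] /isomsP[lg sg]]; apply/isomsP.
  by split=> [a x y|x y]; rewrite !perm1.
by split=> [a x y|x y]; rewrite !permM ?sg // lf lg.
Qed.
Canonical isoms_group := Group isoms_group_set.

Lemma isoms_of (f : 'rV[F]_n -> 'rV[F]_n) : linear f -> injective f ->
  (forall x y, s (f x) (f y) = s x y) ->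
  exists2 g : {perm 'rV[F]_n}, g \in isoms & g =1 f.
Proof.
move=> lf injf sf; exists (perm injf); last exact: permE.
by apply/isomsP; split=> [a x y|x y]; rewrite !permE // lf.
Qed.

End Group.

Lemma isoms_inj (T U : eqType) n (s : 'rV[F]_n -> 'rV[F]_n -> T) (h : T -> U) :
  injective h -> isoms (fun x y => h (s x y)) = isoms s.
Proof.
move=> injh; apply/setP=> f; apply/isomsP/isomsP=> -[lf sf]; split=> // x y.
  exact/injh/sf.
by rewrite sf.
Qed.

Lemma linear_comb m n (f : 'rV[F]_m -> 'rV[F]_n) : linear f ->
  [/\ f 0 = 0, forall x y, f (x + y) = f x + f y, forall x, f (- x) = - f x
    & forall a x, f (a *: x) = a *: f x].
Proof.
move=> lf; pose g : {linear 'rV[F]_m -> 'rV[F]_n} :=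
  HB.pack f (GRing.isLinear.Build _ _ _ _ f lf).
by split; [exact: (raddf0 g)|exact: (raddfD g)|exact: (raddfN g)|exact: (linearZ_LR g)].
Qed.

Section Isometric.
Variable T : eqType.

Definition isometric n1 n2 (s1 : 'rV[F]_n1 -> 'rV[F]_n1 -> T)
    (s2 : 'rV[F]_n2 -> 'rV[F]_n2 -> T) : Prop :=
  exists f : 'rV[F]_n1 -> 'rV[F]_n2,
    [/\ linear f, bijective f & forall x y, s2 (f x) (f y) = s1 x y].

Lemma linear_can n1 n2 (f : 'rV[F]_n1 -> 'rV[F]_n2) g :
  linear f -> cancel f g -> cancel g f -> linear g.
Proof. by move=> lf fK gK a x y; rewrite -{1}[x]gK -{1}[y]gK -lf fK. Qed.

Lemma isometric_ext n (s t : 'rV[F]_n -> 'rV[F]_n -> T) :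
  s =2 t -> isometric s t.
Proof. by move=> st; exists id; split=> //; exists id. Qed.

Lemma isometric_sym n1 n2 (s1 : 'rV[F]_n1 -> 'rV[F]_n1 -> T)
    (s2 : 'rV[F]_n2 -> 'rV[F]_n2 -> T) :
  isometric s1 s2 -> isometric s2 s1.
Proof.
move=> [f [lf [g fK gK] sf]]; exists g; split; first exact: linear_can fK gK.
  by exists f.
by move=> x y; rewrite -sf !gK.
Qed.

Lemma isometric_trans n1 n2 n3 (s1 : 'rV[F]_n1 -> 'rV[F]_n1 -> T)
    (s2 : 'rV[F]_n2 -> 'rV[F]_n2 -> T) (s3 : 'rV[F]_n3 -> 'rV[F]_n3 -> T) :
  isometric s1 s2 -> isometric s2 s3 -> isometric s1 s3.
Proof.
move=> [f [lf bf sf]] [g [lg bg sg]]; exists (g \o f).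
split=> [a x y||x y] /=; [by rewrite lf lg|exact: bij_comp|by rewrite sg sf].
Qed.

Lemma isometric_dim n1 n2 (s1 : 'rV[F]_n1 -> 'rV[F]_n1 -> T)
    (s2 : 'rV[F]_n2 -> 'rV[F]_n2 -> T) : isometric s1 s2 -> n1 = n2.
Proof.
case=> f [_ bf _]; have := bij_eq_card bf; rewrite !card_mx !mul1n => /eqP.
by rewrite eqn_exp2l => [/eqP|] //; exact: card_finNzRing_gt1.
Qed.

(** Conjugation by an isometry identifies the two groups. *)
Lemma card_isoms n1 n2 (s1 : 'rV[F]_n1 -> 'rV[F]_n1 -> T)
    (s2 : 'rV[F]_n2 -> 'rV[F]_n2 -> T) :
  isometric s1 s2 -> #|isoms s1| = #|isoms s2|.
Proof.
have le m1 m2 (t1 : 'rV[F]_m1 -> 'rV[F]_m1 -> T)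
    (t2 : 'rV[F]_m2 -> 'rV[F]_m2 -> T) :
  isometric t1 t2 -> (#|isoms t1| <= #|isoms t2|)%N.
  move=> [f [lf [g fK gK] sf]].
  have lg := linear_can lf fK gK.
  have injc (h : {perm 'rV[F]_m1}) : injective (f \o h \o g).
    by apply: inj_comp (can_inj gK); apply: inj_comp (can_inj fK) perm_inj.
  rewrite -(card_imset _ (f := fun h => perm (injc h))); last first.
    move=> h k /permP hk; apply/permP=> x.
    by have := hk (f x); rewrite !permE /= fK => /(can_inj fK).
  apply/subset_leq_card/subsetP=> _ /imsetP[h /isomsP[lh sh] ->].
  apply/isomsP; split=> [a x y|x y]; rewrite !permE /=.
    by rewrite lg lh lf.
  by rewrite sf sh -sf !gK.
move=> s12; apply/eqP; rewrite eqn_leq !le //; exact: isometric_sym.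
Qed.

End Isometric.

Section Sum.
Variable T : zmodType.

Definition osum n1 n2 (s1 : 'rV[F]_n1 -> 'rV[F]_n1 -> T)
    (s2 : 'rV[F]_n2 -> 'rV[F]_n2 -> T) (x y : 'rV[F]_(n1 + n2)) : T :=
  s1 (lsubmx x) (lsubmx y) + s2 (rsubmx x) (rsubmx y).

Lemma isometric_osumr n1 n2 n3 (s1 : 'rV[F]_n1 -> 'rV[F]_n1 -> T)
    (s2 : 'rV[F]_n2 -> 'rV[F]_n2 -> T) (s3 : 'rV[F]_n3 -> 'rV[F]_n3 -> T) :
  isometric s2 s3 -> isometric (osum s1 s2) (osum s1 s3).
Proof.
move=> [f [lf [g fK gK] sf]].
exists (fun x => row_mx (lsubmx x) (f (rsubmx x))); split.
- by move=> a x y; rewrite !linearP /= lf scale_row_mx add_row_mx.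
- exists (fun x => row_mx (lsubmx x) (g (rsubmx x))) => x;
  by rewrite row_mxKl row_mxKr ?fK ?gK hsubmxK.
- by move=> x y; rewrite /osum !row_mxKl !row_mxKr sf.
Qed.

Lemma isometric_osumC n1 n2 (s1 : 'rV[F]_n1 -> 'rV[F]_n1 -> T)
    (s2 : 'rV[F]_n2 -> 'rV[F]_n2 -> T) :
  isometric (osum s1 s2) (osum s2 s1).
Proof.
exists (fun x => row_mx (rsubmx x) (lsubmx x)); split.
- by move=> a x y; rewrite !linearP /= scale_row_mx add_row_mx.
- exists (fun x => row_mx (rsubmx x) (lsubmx x)) => x;
  by rewrite row_mxKl row_mxKr hsubmxK.
- by move=> x y; rewrite /osum !row_mxKl !row_mxKr addrC.
Qed.

Lemma isometric_osumA n1 n2 n3 (s1 : 'rV[F]_n1 -> 'rV[F]_n1 -> T)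
    (s2 : 'rV[F]_n2 -> 'rV[F]_n2 -> T) (s3 : 'rV[F]_n3 -> 'rV[F]_n3 -> T) :
  isometric (osum (osum s1 s2) s3) (osum s1 (osum s2 s3)).
Proof.
exists (fun x : 'rV_(n1 + n2 + n3) =>
  row_mx (lsubmx (lsubmx x)) (row_mx (rsubmx (lsubmx x)) (rsubmx x))); split.
- by move=> a x y; rewrite !linearP /= !scale_row_mx !add_row_mx.
- exists (fun x : 'rV_(n1 + (n2 + n3)) =>
    row_mx (row_mx (lsubmx x) (lsubmx (rsubmx x))) (rsubmx (rsubmx x))) => x;
  by rewrite !(row_mxKl, row_mxKr) !hsubmxK.
- by move=> x y; rewrite /osum !(row_mxKl, row_mxKr) addrA.
Qed.

Lemma isometric_osum0 n1 (s1 : 'rV[F]_n1 -> 'rV[F]_n1 -> T)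
    (s0 : 'rV[F]_0 -> 'rV[F]_0 -> T) : s0 0 0 = 0 ->
  isometric (osum s1 s0) s1.
Proof.
move=> s00; exists (@lsubmx F 1 n1 0); split.
- by move=> a x y; rewrite linearP.
- exists (fun x => row_mx x 0) => x; last by rewrite row_mxKl.
  by rewrite -[RHS]hsubmxK; congr row_mx; rewrite thinmx0.
- by move=> x y; rewrite /osum !(thinmx0 (rsubmx _)) s00 addr0.
Qed.

(** As soon as the isometries fixing the left summand pointwise are known to
    stabilise the right one, they are the direct sums of the identity and of an
    isometry of the right summand. The second hypothesis will hold by
    orthogonality. *)
Lemma card_isoms_fix_left n1 n2 (s1 : 'rV[F]_n1 -> 'rV[F]_n1 -> T)
    (s2 : 'rV[F]_n2 -> 'rV[F]_n2 -> T) (A : {set {perm 'rV[F]_(n1 + n2)}}) :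
  (forall f, (f \in A) <-> f \in isoms (osum s1 s2) /\
                           forall a, f (row_mx a 0) = row_mx a 0) ->
  (forall f, f \in A -> forall w, lsubmx (f (row_mx 0 w)) = 0) ->
  #|A| = #|isoms s2|.
Proof.
move=> defA stabA.
have inj1 (g : {perm 'rV[F]_n2}) :
    injective (fun x : 'rV[F]_(n1 + n2) => row_mx (lsubmx x) (g (rsubmx x))).
  move=> x y /eq_row_mx[xy /perm_inj xy'].
  by rewrite -[x]hsubmxK -[y]hsubmxK xy xy'.
rewrite -(card_imset _ (f := fun g => perm (inj1 g))); last first.
  move=> g h /permP gh; apply/permP=> w.
  have := gh (row_mx 0 w); rewrite !permE row_mxKl row_mxKr.
  by case/eq_row_mx.
congr #|pred_of_set _|; apply/setP=> f; apply/idP/imsetP; last first.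
  move=> [g /isomsP[lg sg] ->]; apply/defA; split.
    apply/isomsP; split=> [a x y|x y]; rewrite !permE.
      by rewrite !linearP /= lg scale_row_mx add_row_mx.
    by rewrite /osum !row_mxKl !row_mxKr sg.
  move=> a; rewrite permE row_mxKl row_mxKr.
  by have [-> _ _ _] := linear_comb lg.
move=> Af; have /defA[/isomsP[lf sf] fixf] := Af; have stabf := stabA _ Af.
have [f0 fD _ _] := linear_comb lf.
pose g w := rsubmx (f (row_mx 0 w)).
have gE w : f (row_mx 0 w) = row_mx 0 (g w) by rewrite -[LHS]hsubmxK stabf.
have fE x : f x = row_mx (lsubmx x) (g (rsubmx x)).
  rewrite -{1}[x]hsubmxK -[row_mx _ _]addr0 -[X in row_mx _ X]add0r.
  rewrite -[X in row_mx X _]addr0 -add_row_mx addr0 fD fixf gE.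
  by rewrite add_row_mx add0r addr0.
have injg : injective g.
  move=> w w' ww'; have : f (row_mx 0 w) = f (row_mx 0 w') by rewrite !gE ww'.
  by move/perm_inj/eq_row_mx=> [].
exists (perm injg).
  apply/isomsP; split=> [a x y|x y]; rewrite !permE.
    rewrite /g -linearP -lf; congr (rsubmx (f _)).
    by rewrite scale_row_mx add_row_mx scaler0 addr0.
  have := sf (row_mx 0 x) (row_mx 0 y).
  by rewrite /osum !gE !row_mxKl !row_mxKr => /addrI.
by apply/permP=> x; rewrite !permE fE.
Qed.

End Sum.
End Isometries.

Arguments isometric {F T n1 n2}.

(** * Quadratic forms over a finite field *)

Section Orbits.
Variables (T : finType) (G : {group {perm T}}).

Lemma mem_stab x g : (g \in 'C_G[x | 'P])%g = (g \in G) && (g x == x).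
Proof. by rewrite inE; congr andb; apply/astab1P/eqP. Qed.

Lemma card_orbit_fix x (X : {set T}) :
  (forall y, y \in X <-> exists2 g, g \in G & g x = y) ->
  #|G| = (#|X| * #|'C_G[x | 'P]%g|)%N.
Proof.
move=> defX; rewrite -(card_orbit_stab 'P G x); congr (_ * _)%N.
apply: eq_card => y; apply/orbitP/idP => [[g Gg <-]|/defX[g Gg <-]].
  by apply/defX; exists g.
by exists g.
Qed.

End Orbits.

Section QuadraticForms.
Variable F : finFieldType.
Implicit Types (a b c t : F).

Definition polar n (Q : 'rV[F]_n -> F) (x y : 'rV[F]_n) : F :=
  Q (x + y) - Q x - Q y.

Definition quadratic n (Q : 'rV[F]_n -> F) : Prop :=
  [/\ forall a x, Q (a *: x) = a ^+ 2 * Q x,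
      forall x a y z, polar Q x (a *: y + z) = a * polar Q x y + polar Q x z
    & forall x, (forall y, polar Q x y = 0) -> x = 0].

Definition unary n T (Q : 'rV[F]_n -> T) (x _ : 'rV[F]_n) : T := Q x.

Definition zeros n (Q : 'rV[F]_n -> F) : {set 'rV[F]_n} := [set x | Q x == 0].

Section Theory.
Variables (n : nat) (Q : 'rV[F]_n -> F).
Hypothesis quadQ : quadratic Q.
Local Notation B := (polar Q).

Lemma quadZ a x : Q (a *: x) = a ^+ 2 * Q x.
Proof. by have [-> _ _] := quadQ. Qed.

Lemma quadD x y : Q (x + y) = Q x + Q y + B x y.
Proof. by rewrite /polar; ring. Qed.

Lemma quad0 : Q 0 = 0.
Proof. by rewrite -(scale0r 0) quadZ; ring. Qed.

Lemma polarC x y : B x y = B y x.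
Proof. by rewrite /polar [x + y]addrC; ring. Qed.

Lemma polarPr x a y z : B x (a *: y + z) = a * B x y + B x z.
Proof. by have [_ -> _] := quadQ. Qed.

Lemma polarDr x y z : B x (y + z) = B x y + B x z.
Proof. by rewrite -[y]scale1r polarPr !scale1r mul1r. Qed.

Lemma polar0r x : B x 0 = 0.
Proof. by apply: (addrI (B x 0)); rewrite -polarDr !addr0. Qed.

Lemma polarZr x a y : B x (a *: y) = a * B x y.
Proof. by rewrite -[a *: y]addr0 polarPr polar0r addr0. Qed.

Lemma polarNr x y : B x (- y) = - B x y.
Proof. by rewrite -scaleN1r polarZr mulN1r. Qed.

Lemma polarDl x y z : B (y + z) x = B y x + B z x.
Proof. by rewrite !(polarC _ x) polarDr. Qed.

Lemma polarZl x a y : B (a *: y) x = a * B y x.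
Proof. by rewrite !(polarC _ x) polarZr. Qed.

Lemma polarNl x y : B (- y) x = - B y x.
Proof. by rewrite !(polarC _ x) polarNr. Qed.

Lemma quadN x : Q (- x) = Q x.
Proof. by rewrite -scaleN1r quadZ; ring. Qed.

Lemma polarxx x : B x x = 2%:R * Q x.
Proof.
by rewrite /polar -[x]scale1r -scalerDl !quadZ; ring.
Qed.

Lemma polar_nondeg x : (forall y, B x y = 0) -> x = 0.
Proof. by have [_ _ nd] := quadQ; apply: nd. Qed.

Lemma polar_neq0 x : x != 0 -> exists y, B x y != 0.
Proof.
move=> x0; case: (pickP (fun y => B x y != 0)) => [y By|Bx0]; first by exists y.
by case/eqP: x0; apply: polar_nondeg => y; apply/eqP/negPn; rewrite Bx0.
Qed.

Definition polarE :=
  (polarDr, polarDl, polarNr, polarNl, polarZr, polarZl, polar0r).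

Lemma orth_polar g : g \in isoms (unary Q) ->
  forall x y, B (g x) (g y) = B x y.
Proof.
move=> /isomsP[lg sg] x y; have [_ gD _ _] := linear_comb lg.
have gQ z : Q (g z) = Q z by exact: (sg z z).
by rewrite /polar -gD !gQ.
Qed.

Lemma orthP (g : {perm 'rV[F]_n}) :
  g \in isoms (unary Q) <-> linear g /\ forall x, Q (g x) = Q x.
Proof.
split=> [/isomsP[lg sg]|[lg sg]].
  by split=> // x; apply: (sg x x).
by apply/isomsP; split=> // x y; apply: sg.
Qed.

(** A linear map preserving [Q] preserves [B], hence is injective. *)
Lemma orth_of (f : 'rV[F]_n -> 'rV[F]_n) :
  linear f -> (forall x, Q (f x) = Q x) ->
  exists2 g : {perm 'rV[F]_n}, g \in isoms (unary Q) & g =1 f.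
Proof.
move=> lf sf; apply: isoms_of => // [x y fxy|x y]; last exact: sf.
have [_ fD fN _] := linear_comb lf.
apply/eqP; rewrite -subr_eq0; apply/eqP/polar_nondeg => z.
have fB u v : B (f u) (f v) = B u v by rewrite /polar -fD !sf.
by rewrite -fB fD fN fxy subrr polarC polar0r.
Qed.

Lemma reflection_orth w : Q w != 0 ->
  exists2 g : {perm 'rV[F]_n}, g \in isoms (unary Q) &
    forall x, g x = x - (B x w / Q w) *: w.
Proof.
move=> Qw; apply: orth_of => [a x y|x].
  by rewrite !polarE //; apply/rowP=> i; rewrite !mxE; ring.
by rewrite quadD quadN quadZ !polarE; field.
Qed.

(** The Siegel transformation (or Eichler transvection) of a singular vector
    [x] and a vector [w] orthogonal to it. Contrary to products of reflections,
    these suffice for transitivity on hyperbolic pairs even for the sum of two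
    hyperbolic planes over the field with two elements. *)
Lemma siegel_orth x w : Q x = 0 -> B x w = 0 ->
  exists2 g : {perm 'rV[F]_n}, g \in isoms (unary Q) &
    forall v, g v = v + B v x *: w - (B v w + Q w * B v x) *: x.
Proof.
move=> Qx Bxw; apply: orth_of => [a u v|v].
  by rewrite !polarE //; apply/rowP=> i; rewrite !mxE; ring.
rewrite quadD quadN [Q (v + _)]quadD !quadZ !polarE (polarC w x) Bxw Qx.
ring.
Qed.

(** Two singular vectors that are not orthogonal are exchanged by the
    reflection in their difference; otherwise some singular vector is orthogonal
    to neither. *)
Lemma singular_trans x y : x != 0 -> y != 0 -> Q x = 0 -> Q y = 0 ->
  exists2 g : {perm 'rV[F]_n}, g \in isoms (unary Q) & g x = y.
Proof.
have direct u v : Q u = 0 -> Q v = 0 -> B u v != 0 ->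
    exists2 g : {perm 'rV[F]_n}, g \in isoms (unary Q) & g u = v.
  move=> Qu Qv Buv; have Quv : Q (u - v) = - B u v.
    by rewrite quadD quadN polarNr Qu Qv !add0r.
  have [|g Og gE] := @reflection_orth (u - v); first by rewrite Quv oppr_eq0.
  exists g => //; rewrite gE Quv polarDr polarNr polarxx Qu mulr0 add0r.
  by rewrite divff ?oppr_eq0 // scale1r opprB addrCA subrr addr0.
move=> x0 y0 Qx Qy; case: (eqVneq (B x y) 0) => [Bxy|]; last exact: direct.
have [u Bxu] := polar_neq0 x0; have [v Byv] := polar_neq0 y0.
have [w Bxw Byw] : exists2 w, B x w != 0 & B y w != 0.
  case: (eqVneq (B y u) 0) => [Byu|Byu]; last by exists u.
  case: (eqVneq (B x v) 0) => [Bxv|Bxv]; last by exists v.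
  by exists (u + v); rewrite polarDr ?Byu ?Bxv ?addr0 ?add0r.
pose z := w - (Q w / B x w) *: x.
have Qz : Q z = 0.
  by rewrite /z quadD quadN quadZ !polarE (polarC w x) Qx; field.
have [g Og gx] : exists2 g : {perm 'rV[F]_n}, g \in isoms (unary Q) & g x = z.
  by apply: direct => //; rewrite !polarE polarxx Qx !mulr0 subr0.
have [h Oh hz] : exists2 g : {perm 'rV[F]_n}, g \in isoms (unary Q) & g z = y.
  apply: direct => //; rewrite polarC !polarE [B y x]polarC Bxy.
  by rewrite mulr0 subr0.
by exists (g * h)%g; [exact: groupM|rewrite permM gx].
Qed.

(** The Siegel transformation of [x] and [z - y] moves [y] to [z]. *)
Lemma hyperbolic_trans x y z : Q x = 0 -> Q y = 0 -> Q z = 0 ->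
  B x y = 1 -> B x z = 1 ->
  exists2 g : {perm 'rV[F]_n}, g \in isoms (unary Q) & g x = x /\ g y = z.
Proof.
move=> Qx Qy Qz Bxy Bxz.
have [||g Og gE] := @siegel_orth x (z - y) => //.
  by rewrite !polarE Bxy Bxz subrr.
exists g => //; split; rewrite gE.
  by rewrite polarxx !polarE Qx Bxy Bxz !mulr0 subrr !scale0r addr0 addr0 scale0r subr0.
rewrite [B y x]polarC Bxy scale1r !polarE polarxx Qy quadD quadN Qy Qz.
by rewrite polarNr [B z y]polarC; apply/rowP=> i; rewrite !mxE; ring.
Qed.

End Theory.
End QuadraticForms.

(** * Splitting off a hyperbolic plane: counting *)

Section HyperbolicPlane.
Variable F : finFieldType.
Implicit Types (a b c t : F).

Definition row2 a b : 'rV[F]_2 := \row_i (if i == 0 then a else b).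

Lemma row2E a b : (row2 a b 0 0 = a) * (row2 a b 0 1 = b).
Proof. by rewrite !mxE. Qed.

Lemma row2_eta (x : 'rV[F]_2) : x = row2 (x 0 0) (x 0 1).
Proof.
apply/rowP=> i; rewrite mxE.
by case: i => [[|[|i]] hi] //=; congr (x _ _); apply: val_inj.
Qed.

Lemma row2_eq0 a b : (row2 a b == 0) = (a == 0) && (b == 0).
Proof.
apply/eqP/andP=> [ab0|[/eqP-> /eqP->]].
  by have := row2E a b; rewrite ab0 !mxE => -[<- <-]; rewrite eqxx.
by apply/rowP=> i; rewrite !mxE if_same.
Qed.

Lemma row2_basis n (a : 'rV[F]_2) :
  row_mx a (0 : 'rV[F]_n) =
  a 0 0 *: row_mx (row2 1 0) 0 + a 0 1 *: row_mx (row2 0 1) 0.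
Proof.
rewrite !scale_row_mx add_row_mx !scaler0 addr0; congr row_mx.
rewrite [LHS]row2_eta; apply/rowP=> i; rewrite !mxE.
by case: eqP; rewrite ?mulr0 ?mulr1 ?addr0 ?add0r.
Qed.

Definition osumq n1 n2 (Q1 : 'rV[F]_n1 -> F) (Q2 : 'rV[F]_n2 -> F)
    (x : 'rV[F]_(n1 + n2)) : F := Q1 (lsubmx x) + Q2 (rsubmx x).

Lemma polar_osumq n1 n2 (Q1 : 'rV[F]_n1 -> F) (Q2 : 'rV[F]_n2 -> F) x y :
  polar (osumq Q1 Q2) x y =
  polar Q1 (lsubmx x) (lsubmx y) + polar Q2 (rsubmx x) (rsubmx y).
Proof. by rewrite /polar /osumq !linearD /=; ring. Qed.

Lemma quadratic_osumq n1 n2 (Q1 : 'rV[F]_n1 -> F) (Q2 : 'rV[F]_n2 -> F) :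
  quadratic Q1 -> quadratic Q2 -> quadratic (osumq Q1 Q2).
Proof.
move=> q1 q2; split=> [a x|x a y z|x Bx].
- by rewrite /osumq !linearZ /= !quadZ // mulrDr.
- by rewrite !polar_osumq !linearD !linearZ /= !polarPr //; ring.
- rewrite -[x]hsubmxK; apply/eqP; rewrite row_mx_eq0; apply/andP; split.
    apply/eqP/(polar_nondeg q1) => y; have := Bx (row_mx y 0).
    by rewrite polar_osumq row_mxKl row_mxKr (polar0r q2) addr0.
  apply/eqP/(polar_nondeg q2) => y; have := Bx (row_mx 0 y).
  by rewrite polar_osumq row_mxKl row_mxKr (polar0r q1) add0r.
Qed.

Definition hyp (x : 'rV[F]_2) : F := x 0 0 * x 0 1.

Lemma polar_hyp x y : polar hyp x y = x 0 0 * y 0 1 + x 0 1 * y 0 0.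
Proof. by rewrite /polar /hyp !mxE; ring. Qed.

Lemma quadratic_hyp : quadratic hyp.
Proof.
split=> [a x|x a y z|x Bx].
- by rewrite /hyp !mxE; ring.
- by rewrite !polar_hyp !mxE; ring.
- apply/eqP; rewrite [x]row2_eta row2_eq0.
  have := Bx (row2 0 1); have := Bx (row2 1 0).
  by rewrite !polar_hyp !row2E !mulr0 !mulr1 addr0 add0r => -> ->; rewrite eqxx.
Qed.

Section Split.
Variables (n : nat) (Q : 'rV[F]_n -> F).
Hypothesis quadQ : quadratic Q.
Local Notation HQ := (osumq hyp Q).

Lemma quadratic_hyp_osumq : quadratic HQ.
Proof. exact: quadratic_osumq quadratic_hyp quadQ. Qed.
Let quadHQ := quadratic_hyp_osumq.

(** The zeros [(a, b, w)] of [a b + Q w]: if [b = 0] then [w] is a zero of [Q]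
    and [a] is free; otherwise [b] and [w] determine [a]. *)
Lemma card_zeros_hyp :
  #|zeros HQ| = (#|F| * #|zeros Q| + #|F|.-1 * #|F| ^ n)%N.
Proof.
pose f1 (u : F * 'rV[F]_n) := row_mx (row2 u.1 0) u.2.
pose f2 (u : F * 'rV[F]_n) := row_mx (row2 (- Q u.2 / u.1) u.1) u.2.
pose A := f1 @: setX [set: F] (zeros Q).
pose D := f2 @: setX [set~ 0] [set: 'rV[F]_n].
have -> : zeros HQ = A :|: D.
  apply/setP=> x; rewrite !inE; apply/eqP/orP.
    rewrite -[x]hsubmxK [lsubmx x]row2_eta /osumq row_mxKl row_mxKr /hyp !row2E.
    set a := lsubmx x 0 0; set b := lsubmx x 0 1; set w := rsubmx x => Qx.
    case: (eqVneq b 0) => [b0|b0].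
      left; apply/imsetP; exists (a, w) => /=; last by rewrite /f1 b0.
      by rewrite !inE /=; move: Qx; rewrite b0 mulr0 add0r => ->.
    right; apply/imsetP; exists (b, w); first by rewrite !inE b0.
    rewrite /f2 /=; congr (row_mx (row2 _ _) _).
    by rewrite (_ : Q w = - (a * b)) ?opprK ?mulfK //; apply/eqP; rewrite -addr_eq0 addrC Qx.
  have fE a b w : HQ (row_mx (row2 a b) w) = a * b + Q w.
    by rewrite /osumq row_mxKl row_mxKr /hyp !row2E.
  case=> /imsetP[[a w] + ->]; rewrite !inE fE /=.
    by move=> /eqP->; ring.
  by move=> /andP[a0 _]; field.
rewrite cardsU (_ : A :&: D = set0) ?cards0 ?subn0; last first.
  apply/setP=> x; rewrite !inE; apply/negP=> /andP[/imsetP[u _ ->]].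
  case/imsetP=> [[b w]]; rewrite !inE /= => /andP[b0 _].
  case/eq_row_mx=> /(congr1 (fun x : 'rV_2 => x 0 1)).
  by rewrite !row2E /= => b0'; rewrite -b0' eqxx in b0.
rewrite !card_imset; first last.
- move=> [a w] [b v] /eq_row_mx[/(congr1 (fun x : 'rV_2 => x 0 0))].
  by rewrite !row2E /= => -> ->.
- move=> [a w] [b v] /eq_row_mx[/(congr1 (fun x : 'rV_2 => x 0 1))].
  by rewrite !row2E /= => -> ->.
by rewrite !cardsX !cardsT cardsC1 card_mx mul1n.
Qed.

(** The group acts transitively on the nonzero singular vectors, the stabiliser
    of one of them acts transitively on its hyperbolic partners, which are the
    [(- Q w, 1, w)], and the stabiliser of a hyperbolic pair is the group of
    [Q]. *)
Lemma card_orth_hyp :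
  #|isoms (unary HQ)| =
  (#|zeros HQ|.-1 * #|F| ^ n * #|isoms (unary Q)|)%N.
Proof.
pose e : 'rV[F]_(2 + n) := row_mx (row2 1 0) 0.
pose f : 'rV[F]_(2 + n) := row_mx (row2 0 1) 0.
have HQE a b w : HQ (row_mx (row2 a b) w) = a * b + Q w.
  by rewrite /osumq row_mxKl row_mxKr /hyp !row2E.
have rowE (x : 'rV[F]_(2 + n)) :
    x = row_mx (row2 (lsubmx x 0 0) (lsubmx x 0 1)) (rsubmx x).
  by rewrite -row2_eta hsubmxK.
have Q0 := quad0 quadQ.
have Qe : HQ e = 0 by rewrite HQE Q0; ring.
have Qf : HQ f = 0 by rewrite HQE Q0; ring.
have e0 : e != 0 by rewrite row_mx_eq0 row2_eq0 oner_eq0.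
have BeE x : polar HQ e x = lsubmx x 0 1.
  rewrite polar_osumq row_mxKl row_mxKr [polar Q 0 _]polarC polar0r //.
  by rewrite polar_hyp !row2E; ring.
have BfE x : polar HQ f x = lsubmx x 0 0.
  rewrite polar_osumq row_mxKl row_mxKr [polar Q 0 _]polarC polar0r //.
  by rewrite polar_hyp !row2E; ring.
pose G := isoms_group (unary HQ).
rewrite (card_orbit_fix (G := G) (x := e) (X := zeros HQ :\ 0)); last first.
  move=> y; rewrite !inE; split=> [/andP[y0 /eqP Qy]|[g Gg <-]].
    exact: (singular_trans quadHQ).
  have /orthP[lg sg] := Gg; have [g0 _ _ _] := linear_comb lg.
  rewrite sg Qe eqxx andbT; apply: contra_neq e0 => ge0.
  by apply: (@perm_inj _ g); rewrite ge0 g0.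
rewrite (cardsD1 0 (zeros HQ)) inE (quad0 quadHQ) eqxx /= -mulnA.
congr (_ * _)%N.
pose Y := [set row_mx (row2 (- Q w) 1) w | w in [set: 'rV[F]_n]].
rewrite (card_orbit_fix (G := 'C_G[e | 'P]%G) (x := f) (X := Y)); last first.
  move=> y; split=> [/imsetP[w _ ->]|[g]].
    have [|||||g Gg [ge gf]] :=
      @hyperbolic_trans _ _ _ quadHQ e f (row_mx (row2 (- Q w) 1) w) => //.
    - by rewrite HQE; ring.
    - by rewrite BeE row_mxKl row2E.
    - by rewrite BeE row_mxKl row2E.
    by exists g => //; rewrite mem_stab ge eqxx andbT.
  rewrite mem_stab => /andP[Gg /eqP ge] <-.
  have /orthP[lg sg] := Gg.
  have Bgf : lsubmx (g f) 0 1 = 1.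
    by rewrite -BeE -{1}ge (orth_polar Gg) BeE row_mxKl row2E.
  have Qgf : lsubmx (g f) 0 0 = - Q (rsubmx (g f)).
    have := sg f; rewrite Qf [g f]rowE HQE Bgf mulr1 row_mxKl row_mxKr row2E.
    by move/eqP; rewrite addr_eq0 => /eqP.
  by apply/imsetP; exists (rsubmx (g f)) => //; rewrite -Qgf -Bgf -rowE.
rewrite card_imset ?cardsT ?card_mx ?mul1n; last by move=> w v /eq_row_mx[].
congr (_ * _)%N; apply: (@card_isoms_fix_left _ _ 2 n (unary hyp)).
  move=> g; rewrite !mem_stab -andbA; split.
    case/and3P=> Gg /eqP ge /eqP gf; split=> // a.
    have /orthP[lg _] := Gg; have [_ gD _ gZ] := linear_comb lg.
    by rewrite row2_basis gD !gZ ge gf.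
  by case=> Gg fixg; rewrite [g \in _]Gg !fixg !eqxx.
move=> g; rewrite !mem_stab -andbA => /and3P[Gg /eqP ge /eqP gf] w.
rewrite [LHS]row2_eta; apply/eqP; rewrite row2_eq0 -BeE -BfE.
by rewrite -{1}ge -{1}gf !(orth_polar Gg) BeE BfE row_mxKl !mxE eqxx.
Qed.

End Split.
End HyperbolicPlane.

(** * Splitting off a hyperbolic plane: existence *)

Section Splitting.
Variable F : finFieldType.
Implicit Types (a b c t : F).

Lemma linear_mulmx m n (f : 'rV[F]_m -> 'rV[F]_n) :
  linear f -> exists A, forall u, f u = u *m A.
Proof.
move=> lf; pose g : {linear 'rV[F]_m -> 'rV[F]_n} :=
  HB.pack f (GRing.isLinear.Build _ _ _ _ f lf).
by exists (lin1_mx g) => u; rewrite mul_rV_lin1.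
Qed.

Definition functional n (u : 'rV[F]_n -> F) : Prop :=
  forall a x y, u (a *: x + y) = a * u x + u y.

Lemma linear_row2 n (u v : 'rV[F]_n -> F) : functional u -> functional v ->
  linear (fun x => row2 (u x) (v x)).
Proof.
by move=> fu fv a x y; apply/rowP=> i; rewrite !mxE; case: ifP => _; rewrite ?fu ?fv.
Qed.

Lemma functional_coord n (i : 'I_n) : functional (fun x => x 0 i).
Proof. by move=> a x y; rewrite !mxE. Qed.

Lemma functional_polar n (Q : 'rV[F]_n -> F) x :
  quadratic Q -> functional (polar Q x).
Proof. by move=> qQ a y z; rewrite (polarPr qQ). Qed.

Lemma linear_kernel_neq0 m n (f : 'rV[F]_m -> 'rV[F]_n) :
  linear f -> (n < m)%N -> exists2 z, z != 0 & f z = 0.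
Proof.
move=> lf nm; have [A fA] := linear_mulmx lf.
have : kermx A != 0.
  by rewrite -mxrank_eq0 mxrank_ker subn_eq0 -ltnNge (leq_ltn_trans (rank_leq_col A)).
by case/rowV0Pn=> z /sub_kermxP zA z0; exists z; rewrite // fA.
Qed.

Lemma common_kernel_neq0 n (u v : 'rV[F]_n -> F) : functional u -> functional v ->
  (2 < n)%N -> exists2 z, z != 0 & u z = 0 /\ v z = 0.
Proof.
move=> fu fv /(linear_kernel_neq0 (linear_row2 fu fv))[z z0 /eqP].
by rewrite row2_eq0 => /andP[/eqP uz /eqP vz]; exists z.
Qed.

Lemma kernel_neq0 n (u : 'rV[F]_n -> F) : functional u ->
  (1 < n)%N -> exists2 z, z != 0 & u z = 0.
Proof.
move=> fu n1; have lu : linear (fun x => (u x)%:M : 'rV[F]_1).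
  by move=> a x y; apply/rowP=> i; rewrite !mxE fu !ord1 eqxx.
have [z z0 /rowP/(_ 0)] := linear_kernel_neq0 lu n1.
by rewrite !mxE eqxx => uz; exists z.
Qed.

(** Two vectors dual to two functionals span a complement of their common
    kernel, which is here given coordinates. *)
Lemma split_plane n (u v : 'rV[F]_n -> F) x y :
  functional u -> functional v -> u x = 1 -> u y = 0 -> v x = 0 -> v y = 1 ->
  exists r (psi : 'rV[F]_r -> 'rV[F]_n),
  [/\ linear psi, forall w, u (psi w) = 0 /\ v (psi w) = 0 &
    bijective (fun z : 'rV[F]_(2 + r) =>
      lsubmx z 0 0 *: x + lsubmx z 0 1 *: y + psi (rsubmx z))].
Proof.
move=> fu fv ux uy vx vy.
have [A fA] := linear_mulmx (linear_row2 fu fv).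
pose K := row_base (kermx A); exists (\rank (kermx A)), (fun w => w *m K).
have uvK w : u (w *m K) = 0 /\ v (w *m K) = 0.
  have : (w *m K <= kermx A)%MS.
    by rewrite (submx_trans (submxMl _ _)) // eq_row_base.
  move/sub_kermxP; rewrite -fA => /eqP.
  by rewrite row2_eq0 => /andP[/eqP-> /eqP->].
have fuD w z : u (w + z) = u w + u z.
  by rewrite -[w]scale1r fu scale1r mul1r.
have fvD w z : v (w + z) = v w + v z.
  by rewrite -[w]scale1r fv scale1r mul1r.
have u0 : u 0 = 0 by apply: (addrI (u 0)); rewrite -fuD !addr0.
have v0 : v 0 = 0 by apply: (addrI (v 0)); rewrite -fvD !addr0.
have fuZ a w : u (a *: w) = a * u w by rewrite -[a *: w]addr0 fu u0 addr0.
have fvZ a w : v (a *: w) = a * v w by rewrite -[a *: w]addr0 fv v0 addr0.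
split=> // [a w z|].
  by rewrite mulmxDl scalemxAl.
have uE a b w : u (a *: x + b *: y + w *m K) = a.
  by rewrite !fuD !fuZ ux uy (uvK w).1; ring.
have vE a b w : v (a *: x + b *: y + w *m K) = b.
  by rewrite !fvD !fvZ vx vy (uvK w).2; ring.
exists (fun z => row_mx (row2 (u z) (v z))
    ((z - u z *: x - v z *: y) *m pinvmx K)) => z.
  rewrite uE vE -[RHS]hsubmxK [lsubmx z in RHS]row2_eta; congr row_mx.
  rewrite (_ : _ - _ - _ = rsubmx z *m K).
    by rewrite -mulmxA mulmxVp ?row_base_free // mulmx1.
  by apply/rowP=> i; rewrite !mxE; ring.
rewrite row_mxKl row_mxKr !row2E mulmxKpV; first by apply/rowP=> i; rewrite !mxE; ring.
rewrite eq_row_base; apply/sub_kermxP; rewrite -fA; apply/eqP.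
rewrite row2_eq0 -addrA !fuD !fvD -!scaleNr !fuZ !fvZ ux uy vx vy.
by apply/andP; split; apply/eqP; ring.
Qed.

(** A nonzero singular vector [x] has a partner [y0] not orthogonal to it;
    subtracting a multiple of [x] makes the partner singular. *)
Lemma split_hyperbolic n (Q : 'rV[F]_n -> F) x : quadratic Q ->
  x != 0 -> Q x = 0 ->
  exists r (Q' : 'rV[F]_r -> F), quadratic Q' /\
    isometric (unary (osumq (@hyp F) Q')) (unary Q).
Proof.
move=> qQ x0 Qx; have [y0 By0] := polar_neq0 qQ x0.
pose y1 := (polar Q x y0)^-1 *: y0.
have By1 : polar Q x y1 = 1 by rewrite /y1 (polarZr qQ) mulVf.
pose y := y1 - Q y1 *: x.
have Bxx : polar Q x x = 0 by rewrite (polarxx qQ) Qx mulr0.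
have Bxy : polar Q x y = 1 by rewrite (polarDr qQ) (polarNr qQ) (polarZr qQ) Bxx By1; ring.
have Qy : Q y = 0.
  by rewrite /y quadD (quadN qQ) (quadZ qQ) Qx (polarNr qQ) (polarZr qQ) polarC By1; ring.
have Byy : polar Q y y = 0 by rewrite (polarxx qQ) Qy mulr0.
have [||||||r [psi [lpsi orth bpsi]]] := @split_plane _ (polar Q y) (polar Q x) x y => //.
- exact: functional_polar.
- exact: functional_polar.
- by rewrite polarC.
have [p0 pD pN pZ] := linear_comb lpsi.
have polp w w' : polar (Q \o psi) w w' = polar Q (psi w) (psi w').
  by rewrite /polar /= pD.
have [phi phiK Kphi] := bpsi.
exists r, (Q \o psi); split.
  split=> [a w|w a w1 w2|w Bw].
  - by rewrite /= pZ quadZ.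
  - by rewrite !polp pD pZ (polarPr qQ).
  - have : psi w = 0.
      apply: (polar_nondeg qQ) => v; rewrite -[v]Kphi.
      rewrite !(polarDr qQ) !(polarZr qQ) -polp Bw.
      by rewrite !(polarC _ (psi w)) (orth w).1 (orth w).2; ring.
    move=> psiw; have := phiK (row_mx 0 w); have := phiK 0.
    rewrite row_mxKl row_mxKr !linear0 !mxE psiw p0 !scale0r !addr0 => -> /eqP.
    by rewrite eq_sym row_mx_eq0 => /andP[_ /eqP].
exists (fun z : 'rV[F]_(2 + r) =>
  lsubmx z 0 0 *: x + lsubmx z 0 1 *: y + psi (rsubmx z)).
split=> // [a z1 z2|z z'].
  rewrite !linearP /= lpsi; apply/rowP=> i; rewrite !mxE; ring.
rewrite /unary /osumq /hyp /= 2!quadD !(quadZ qQ) !(polarDl qQ) !(polarZl qQ) !(polarZr qQ).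
by rewrite (orth _).1 (orth _).2 Qx Qy Bxy; ring.
Qed.

End Splitting.

(** * Anisotropic forms *)

Section Anisotropic.
Variable F : finFieldType.
Implicit Types (a b c d t s : F).

Definition anisotropic n (Q : 'rV[F]_n -> F) := forall x, Q x = 0 -> x = 0.

(** A fibre of squaring has at most two elements, and the fibre of [0] only one. *)
Lemma ltn_card_squares : (#|F| < 2 * #|[set (t ^+ 2 : F) | t in F]|)%N.
Proof.
set S := [set _ | t in F].
have S0 : 0 \in S by apply/imsetP; exists 0; rewrite ?expr0n.
pose rt (v : F) := odflt 0 [pick t : F | t ^+ 2 == v].
have rtE t : rt (t ^+ 2) = t \/ rt (t ^+ 2) = - t.
  rewrite /rt; case: pickP => [s /= |/(_ t)]; last by rewrite eqxx.
  by rewrite eqf_sqr => /orP[]/eqP; auto.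
set S1 := S :\ 0; have cS : #|S| = #|S1|.+1 by rewrite (cardsD1 0 S) S0.
pose A1 : {set F} := rt @: S1; pose A2 : {set F} := [set - rt v | v in S1].
have sub : [set: F] \subset 0 |: (A1 :|: A2).
  apply/subsetP=> t _; rewrite !inE; case: eqVneq => //= t0.
  have St : t ^+ 2 \in S1.
    by rewrite !inE sqrf_eq0 t0; apply/imsetP; exists t.
  apply/orP; case: (rtE t) => [<-|/(congr1 -%R)]; first by left; apply: imset_f.
  by rewrite opprK => {2}<-; right; apply/imsetP; exists (t ^+ 2).
have le1 : (#|A1| <= #|S1|)%N := leq_imset_card _ _.
have le2 : (#|A2| <= #|S1|)%N := leq_imset_card _ _.
have leU : (#|A1 :|: A2| <= #|S1| + #|S1|)%N.
  by rewrite cardsU (leq_trans (leq_subr _ _)) // leq_add.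
have := subset_leq_card sub; rewrite cardsT => /leq_ltn_trans; apply.
rewrite cS cardsU1 mul2n -addnn addSn addnS ltnS.
by apply: (leq_add (leq_b1 _) leU).
Qed.

(** The sets of values of [a t^2] and [c - d s^2] each contain more than half
    of the field, so they meet. *)
Lemma binary_universal a d c : a != 0 -> d != 0 ->
  exists t s, a * t ^+ 2 + d * s ^+ 2 = c.
Proof.
move=> a0 d0; set S := [set (t ^+ 2 : F) | t in F].
pose A := [set a * v | v in S]; pose D := [set c - d * v | v in S].
have cA : #|A| = #|S| by rewrite card_imset //; apply: mulfI.
have cD : #|D| = #|S|.
  by rewrite card_imset // => u v /addrI/oppr_inj/(mulfI d0).
have : (0 < #|A :&: D|)%N.
  rewrite lt0n; apply/negP=> /eqP AD0; have := max_card (A :|: D).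
  rewrite cardsU AD0 subn0 cA cD addnn -mul2n leqNgt => /negP; apply.
  exact: ltn_card_squares.
case/card_gt0P=> u; rewrite inE => /andP[].
move=> /imsetP[_ /imsetP[t _ ->] ->] /imsetP[_ /imsetP[s _ ->] E].
by exists t, s; rewrite E subrK.
Qed.

Lemma char2_sqr_onto : 2%:R = 0 :> F -> forall c, exists t, t ^+ 2 = c.
Proof.
move=> F2 c; have inj : injective (fun t : F => t ^+ 2).
  move=> t s /eqP; rewrite eqf_sqr => /orP[]/eqP-> //.
  by apply/eqP; rewrite -subr_eq0 -opprD -mulr2n -mulr_natl F2 mul0r oppr0.
by have [g _ gK] := injF_bij inj; exists (g c).
Qed.

Section Theory.
Variables (n : nat) (Q : 'rV[F]_n -> F).
Hypotheses (quadQ : quadratic Q) (anisoQ : anisotropic Q).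
Local Notation B := (polar Q).

Let Q_neq0 x : x != 0 -> Q x != 0.
Proof. by apply: contra_neq; apply: anisoQ. Qed.

Lemma exists_neq0 : (0 < n)%N -> exists x : 'rV[F]_n, x != 0.
Proof.
move=> n0; exists (const_mx 1); apply/eqP=> /rowP/(_ (Ordinal n0))/eqP.
by rewrite !mxE oner_eq0.
Qed.

(** In three orthogonal directions [x], [y], [z] the plane of [x] and [y]
    represents [- Q z], whence a zero. Orthogonality does not give independence
    in characteristic 2, but there two directions already suffice, every scalar
    being a square. *)
Lemma anisotropic_dim : (n <= 2)%N.
Proof.
rewrite leqNgt; apply/negP=> n2.
have [x x0] := exists_neq0 (ltnW (ltnW n2)).
case: (eqVneq (2%:R : F) 0) => F2.
  (* [y] is orthogonal to [x] and, having a zero coordinate where [x] does not,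
     independent of it; [Q (t x + y) = t^2 Q x + Q y] then vanishes for some [t]. *)
  have /existsP[i xi] : [exists i, x 0 i != 0].
    rewrite -negb_forall; apply: contra x0 => /forallP x0.
    by apply/eqP/rowP=> i; rewrite mxE; apply/eqP.
  have [y y0 [Bxy yi]] :=
    common_kernel_neq0 (functional_polar x quadQ) (functional_coord i) n2.
  have [t tE] := char2_sqr_onto F2 (Q y / Q x).
  have /anisoQ/rowP/(_ i) : Q (t *: x + y) = 0.
    rewrite quadD (quadZ quadQ) (polarZl quadQ) Bxy tE divfK ?Q_neq0 //.
    by rewrite mulr0 addr0 -mulr2n -mulr_natl F2 mul0r.
  rewrite !mxE yi addr0 => /eqP; rewrite mulf_eq0 (negbTE xi) orbF => /eqP t0.
  move/eqP: tE; rewrite t0 expr0n eq_sym mulf_eq0 invr_eq0 !(negbTE (Q_neq0 _)) //.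
have fx := functional_polar x quadQ.
have [y y0 [Bxy _]] := common_kernel_neq0 fx fx n2.
have [z z0 [Bxz Byz]] := common_kernel_neq0 fx (functional_polar y quadQ) n2.
have [t [s ts]] := binary_universal (- Q z) (Q_neq0 x0) (Q_neq0 y0).
have /anisoQ : Q (t *: x + s *: y + z) = 0.
  rewrite 2!quadD !(polarDl quadQ) !(polarZl quadQ) !(polarZr quadQ) !(quadZ quadQ).
  by rewrite Bxy Bxz Byz; move: ts => /(canRL (addrK _)) ts; rewrite [t ^+ 2 * _]mulrC ts; ring.
move/(congr1 (B z)); rewrite !(polarDr quadQ) !(polarZr quadQ) (polarxx quadQ) (polar0r quadQ).
rewrite ![B z _]polarC Bxz Byz !mulr0 !add0r => /eqP.
by rewrite mulf_eq0 (negbTE F2) (negbTE (Q_neq0 z0)).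
Qed.

Lemma anisotropic_universal : (1 < n)%N -> forall c, exists x, Q x = c.
Proof.
move=> n1 c; have [x x0] := exists_neq0 (ltnW n1).
case: (eqVneq (2%:R : F) 0) => F2.
  have [t tE] := char2_sqr_onto F2 (c / Q x).
  by exists (t *: x); rewrite (quadZ quadQ) tE divfK // Q_neq0.
have [y y0 Bxy] := kernel_neq0 (functional_polar x quadQ) n1.
have [t [s ts]] := binary_universal c (Q_neq0 x0) (Q_neq0 y0).
exists (t *: x + s *: y); rewrite quadD !(quadZ quadQ) (polarZl quadQ).
by rewrite (polarZr quadQ) Bxy -ts; ring.
Qed.

(** As [x - y] is not singular, the reflection it defines is available. *)
Lemma anisotropic_trans x y : Q x = Q y ->
  exists2 g : {perm 'rV[F]_n}, g \in isoms (unary Q) & g x = y.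
Proof.
case: (eqVneq x y) => [-> _|xy Qxy]; first by exists 1%g; [exact: group1|rewrite perm1].
have Q0 : Q (x - y) != 0 by rewrite Q_neq0 // subr_eq0.
have [g Og gE] := reflection_orth quadQ Q0; exists g => //.
have E : B x (x - y) = Q (x - y).
  by rewrite (quadD Q) (quadN quadQ) !(polarDr quadQ) !(polarNr quadQ) (polarxx quadQ) -Qxy; ring.
by rewrite gE E divff // scale1r opprB addrCA subrr addr0.
Qed.

Lemma card_orth_level x (c := Q x) :
  #|isoms (unary Q)| = (#|[set y | Q y == c]| *
                        #|'C_(isoms_group (unary Q))[x | 'P]%g|)%N.
Proof.
apply: card_orbit_fix => y; rewrite inE; split=> [/eqP Qy|[g Og <-]].
  exact: anisotropic_trans.
by have /orthP[_ ->] := Og.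
Qed.

End Theory.

(** The nontrivial element of the stabiliser of [x] is the reflection in a
    vector [w] orthogonal to [x]; in characteristic 2, [w] is a multiple of
    [x]. *)
Lemma card_stab_aniso_plane (Q : 'rV[F]_2 -> F) x :
  quadratic Q -> anisotropic Q -> x != 0 ->
  #|'C_(isoms_group (unary Q))[x | 'P]%g| = 2%N.
Proof.
move=> qQ aQ x0.
have [w w0 Bxw] := kernel_neq0 (functional_polar x qQ) isT.
have Qw : Q w != 0 by apply: contra_neq w0; apply: aQ.
have [y Bwy] := polar_neq0 qQ w0.
have span v : exists a b, v = a *: x + b *: y.
  have free : row_free (col_mx x y).
    apply/row_freeP; apply/row_freeP; rewrite -kermx_eq0; apply/eqP/row_matrixP=> i.
    set u := row i _; have : u *m col_mx x y = 0.
      by rewrite /u -row_mul mulmx_ker row0.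
    rewrite row0 -[u]hsubmxK mul_row_col => uxy.
    have lE (z : 'rV[F]_1) (t : 'rV[F]_2) : z *m t = z 0 0 *: t.
      by rewrite [z in LHS]mx11_scalar mul_scalar_mx.
    rewrite !lE in uxy.
    have b0 : rsubmx u 0 0 = 0.
      have := congr1 (polar Q w) uxy.
      rewrite (polarDr qQ) !(polarZr qQ) (polar0r qQ) polarC Bxw mulr0 add0r => /eqP.
      by rewrite mulf_eq0 (negbTE Bwy) orbF => /eqP.
    have a0 : lsubmx u 0 0 = 0.
      by move/eqP: uxy; rewrite b0 scale0r addr0 scaler_eq0 (negbTE x0) orbF => /eqP.
    by rewrite [lsubmx u]mx11_scalar [rsubmx u]mx11_scalar a0 b0 !raddf0 row_mx0.
  have full : row_full (col_mx x y) by exact: free.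
  have /submxP[u ->] : (v <= col_mx x y)%MS by rewrite submx_full.
  exists (lsubmx (u : 'rV_(1 + 1)) 0 0), (rsubmx (u : 'rV_(1 + 1)) 0 0).
  rewrite -{1}[u](@hsubmxK _ 1 1 1) mul_row_col.
  by rewrite {1}[lsubmx _]mx11_scalar {1}[rsubmx _]mx11_scalar !mul_scalar_mx.
have [r Or rE] := reflection_orth qQ Qw.
have rx : r x = x by rewrite rE Bxw mul0r scale0r subr0.
have Byw : polar Q y w != 0 by rewrite polarC.
have ry : r y != y.
  rewrite rE -subr_eq0 addrAC subrr add0r oppr_eq0 scaler_eq0 (negbTE w0).
  by rewrite mulf_eq0 invr_eq0 (negbTE Byw) (negbTE Qw).
have -> : 'C_(isoms_group (unary Q))[x | 'P]%g = [set 1%g; r].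
  apply/setP=> g; rewrite mem_stab in_set2; apply/andP/orP=> [|[]/eqP->];
    [|by rewrite group1 perm1 eqxx|by rewrite Or rx eqxx].
  move=> [Og /eqP gx]; have /orthP[lg Qg] := Og.
  have [_ gD _ gZ] := linear_comb lg.
  have eqg (h : {perm 'rV[F]_2}) : h \in isoms (unary Q) -> h x = x -> g y = h y -> g = h.
    move=> /orthP[lh _] hx ghy; have [_ hD _ hZ] := linear_comb lh.
    by apply/permP=> v; have [a [b ->]] := span v; rewrite gD hD !gZ !hZ gx hx ghy.
  have [t gyE] : exists t, g y = y + t *: w.
    have [z zE] : exists z, g y = y + z by exists (g y - y); rewrite addrC subrK.
    exists (polar Q y z / polar Q y w); rewrite zE; congr (_ + _).
    have Bxz : polar Q x z = 0.
      by apply: (addrI (polar Q x y)); rewrite -(polarDr qQ) -zE -{1}gx (orth_polar Og) addr0.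
    apply/eqP; rewrite -subr_eq0; apply/eqP/(polar_nondeg qQ) => v.
    have [a [b ->]] := span v; rewrite polarC.
    rewrite !(polarDr qQ, polarDl qQ, polarNr qQ, polarZr qQ, polarZl qQ).
    by rewrite Bxz Bxw; field.
  have : t * (polar Q y w + t * Q w) = 0.
    have := Qg y; rewrite gyE quadD (quadZ qQ) (polarZr qQ) => /(canRL (addrK _))/(canRL (addKr _)).
    move=> E; rewrite mulrDr mulrA -expr2 E; ring.
  move/eqP; rewrite mulf_eq0 => /orP[/eqP t0|].
    by left; apply/eqP/eqg; rewrite ?group1 ?perm1 // gyE t0 scale0r addr0.
  rewrite addrC addr_eq0 => /eqP tw; right; apply/eqP/eqg => //.
  rewrite gyE rE -scaleNr; congr (_ + _ *: _).
  by apply: (mulIf Qw); rewrite tw mulNr divfK.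
rewrite cards2 (_ : 1%g != r) //; apply/eqP=> r1.
by rewrite -r1 perm1 eqxx in ry.
Qed.

(** Every nonzero value is taken, and the vectors with a given nonzero value
    form an orbit with stabiliser of order 2. Writing [N] for the order of the
    group and summing over the values, [(q - 1) * N = 2 * (q ^ 2 - 1)]. *)
Lemma card_orth_aniso_plane (Q : 'rV[F]_2 -> F) :
  quadratic Q -> anisotropic Q -> #|isoms (unary Q)| = (2 * #|F|.+1)%N.
Proof.
move=> qQ aQ; have F1 := card_finNzRing_gt1 F.
have Q0 : [set y | Q y == 0] = [set 0].
  apply/setP=> y; rewrite !inE; apply/eqP/eqP=> [/aQ //|->]; exact: quad0.
have : (#|F| ^ 2 = 1 + \sum_(c : F | c != 0%R) #|[set y | Q y == c]|)%N.
  have -> : (#|F| ^ 2 = #|{: 'rV[F]_2}|)%N by rewrite card_mx.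
  rewrite -sum1_card (partition_big Q predT) //= (bigD1 0) //=.
  by rewrite sum1dep_card Q0 cards1; congr (_ + _)%N; apply: eq_bigr => c _; rewrite sum1dep_card.
move/(congr1 (muln 2)); rewrite mulnDr big_distrr /=.
rewrite (eq_bigr (fun=> #|isoms (unary Q)|)) => [|c c0]; last first.
  have [x Qx] := anisotropic_universal qQ aQ isT c.
  rewrite (card_orth_level qQ aQ x) card_stab_aniso_plane // ?Qx 1?mulnC //.
  by apply: contra_neq c0 => x0; rewrite -Qx x0 quad0.
rewrite sum_nat_const (_ : #|_| = #|F|.-1); last first.
  by rewrite -(cardC1 (0 : F)); apply: eq_card => c; rewrite !inE.
move: F1; case: #|F| => [|[|q]] //= _; nia.
Qed.

Lemma card_orth_line (Q : 'rV[F]_1 -> F) :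
  2%:R != 0 :> F -> quadratic Q -> #|isoms (unary Q)| = 2%N.
Proof.
move=> F2 qQ; pose e : 'rV[F]_1 := const_mx 1.
have eE (v : 'rV[F]_1) : v = v 0 0 *: e by apply/rowP=> i; rewrite !mxE !ord1 mulr1.
have e0 : e != 0.
  apply/eqP=> /(congr1 (fun z : 'rV_1 => z 0 0))/eqP.
  by rewrite !mxE oner_eq0.
have Qe : Q e != 0.
  have [y] := polar_neq0 qQ e0; rewrite [y]eE (polarZr qQ) (polarxx qQ).
  by apply: contra_neq => ->; rewrite !mulr0.
have [r Or rE] := reflection_orth qQ Qe.
have re : r e = - e.
  by rewrite rE (polarxx qQ) mulfK // scaler_nat mulr2n opprD addrA subrr add0r.
have -> : isoms (unary Q) = [set 1%g; r].
  apply/setP=> g; rewrite in_set2.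
  apply/idP/orP=> [|[]/eqP->]; [|exact: (group1 (isoms_group (unary Q)))|by []].
  move=> Og; have /orthP[lg Qg] := Og; have [_ _ _ gZ] := linear_comb lg.
  have /orthP[lr _] := Or; have [_ _ _ rZ] := linear_comb lr.
  have /eqP : g e 0 0 ^+ 2 = 1 ^+ 2.
    by apply: (mulIf Qe); rewrite -(quadZ qQ) -eE Qg expr1n mul1r.
  rewrite eqf_sqr => /orP[]/eqP ge; [left|right]; apply/eqP/permP=> v;
    rewrite [v]eE gZ ?perm1 ?rZ ?re; congr (_ *: _); rewrite [g e]eE ge.
    by rewrite scale1r.
  by rewrite scaleN1r.
rewrite cards2 (_ : 1%g != r) //; apply/eqP=> r1.
have : e + e = 0 by rewrite -{1}[e]perm1 r1 re addNr.
move/rowP/(_ 0)/eqP; rewrite !mxE -mulr2n; exact/negP.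
Qed.

Lemma card_isoms_dim0 (T : eqType) (s : 'rV[F]_0 -> 'rV[F]_0 -> T) :
  #|isoms s| = 1%N.
Proof.
apply: (etrans _ (cards1 (1%g : {perm 'rV[F]_0}))); congr #|pred_of_set _|.
apply/setP=> g; rewrite in_set1.
have -> : g = 1%g by apply/permP=> x; rewrite perm1 [LHS]thinmx0 [RHS]thinmx0.
by rewrite eqxx (group1 (isoms_group s)).
Qed.

End Anisotropic.

(** * Witt decomposition and orders of orthogonal groups *)

Section WittDecomposition.
Variable F : finFieldType.
Local Notation q := #|F|.

Lemma quadratic0 : quadratic (fun _ : 'rV[F]_0 => 0 : F).
Proof.
by split=> [a x|x a y z|x _]; rewrite /polar; [ring|ring|exact: thinmx0].
Qed.

Fixpoint hyps m : 'rV[F]_(m * 2) -> F :=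
  match m with
  | 0 => fun _ => 0
  | m'.+1 => osumq (@hyp F) (@hyps m')
  end.

Lemma isometric_hyps_osumq m k (Q0 : 'rV[F]_k -> F) :
  isometric (unary (osumq (@hyps m.+1) Q0))
            (unary (osumq (@hyp F) (osumq (@hyps m) Q0))).
Proof.
exact: (isometric_osumA (unary (@hyp F)) (unary (@hyps m)) (unary Q0)).
Qed.

Lemma isometric_hyps0_osumq k (Q0 : 'rV[F]_k -> F) :
  isometric (unary (osumq (@hyps 0) Q0)) (unary Q0).
Proof.
apply: isometric_trans (isometric_osumC (unary (@hyps 0)) (unary Q0)) _.
exact: isometric_osum0.
Qed.

Lemma quadratic_hyps m k (Q0 : 'rV[F]_k -> F) :
  quadratic Q0 -> quadratic (osumq (@hyps m) Q0).
Proof.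
move=> q0; apply: quadratic_osumq => //; elim: m => [|m IH]; first exact: quadratic0.
exact: quadratic_osumq (@quadratic_hyp F) IH.
Qed.

Theorem witt_decomposition n (Q : 'rV[F]_n -> F) : quadratic Q ->
  exists m k (Q0 : 'rV[F]_k -> F),
    [/\ quadratic Q0, anisotropic Q0, (k <= 2)%N &
        isometric (unary (osumq (@hyps m) Q0)) (unary Q)].
Proof.
elim/ltn_ind: n Q => n IH Q qQ.
case: (pickP (fun x : 'rV[F]_n => (x != 0) && (Q x == 0))) => [x|aQ].
  case/andP=> x0 /eqP Qx; have [r [Q' [qQ' isoQ]]] := split_hyperbolic qQ x0 Qx.
  have rn : (r < n)%N by rewrite -(isometric_dim isoQ) add2n ltnS.
  have [m [k [Q0 [q0 a0 k2 iso0]]]] := IH r rn Q' qQ'.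
  exists m.+1, k, Q0; split=> //.
  apply: isometric_trans (isometric_hyps_osumq _ _) _.
  apply: isometric_trans isoQ; exact: (isometric_osumr (unary (@hyp F)) iso0).
have an : anisotropic Q.
  by move=> x Qx; apply/eqP/negPn/negP=> x0; have := aQ x; rewrite x0 Qx eqxx.
exists 0%N, n, Q; split=> //; first exact: anisotropic_dim qQ an.
exact: isometric_hyps0_osumq.
Qed.

Lemma card_level_isometric (T : eqType) n1 n2 (Q1 : 'rV[F]_n1 -> T)
    (Q2 : 'rV[F]_n2 -> T) c :
  isometric (unary Q1) (unary Q2) ->
  #|[set x | Q1 x == c]| = #|[set x | Q2 x == c]|.
Proof.
case=> f [_ [g fK gK] fQ]; have {}fQ x : Q2 (f x) = Q1 x := fQ x x.
rewrite -(card_imset _ (can_inj fK)).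
congr #|pred_of_set _|; apply/setP=> x; apply/imsetP/idP=> [[y + ->]|].
  by rewrite !inE fQ.
by rewrite inE -{1}[x]gK fQ => Qx; exists (g x); rewrite ?inE ?gK.
Qed.

Section Orders.
Variables (k : nat) (Q0 : 'rV[F]_k -> F).
Hypotheses (quadQ0 : quadratic Q0) (anisoQ0 : anisotropic Q0).
Local Notation Q m := (osumq (@hyps m) Q0).

(** The predecessor [(m + k).-1] is truncated only for [m = k = 0], where the
    factor [q ^ m - 1] vanishes. *)
Lemma card_zeros_witt m :
  #|zeros (Q m)| = ((q ^ m - 1) * (q ^ (m + k).-1 + 1)).+1%N.
Proof.
have q1 := card_finNzRing_gt1 F.
elim: m => [|m IH].
  apply: etrans (card_level_isometric 0 (isometric_hyps0_osumq Q0)) _.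
  rewrite expn0 subnn mul0n.
  rewrite (_ : [set x | _] = [set 0]) ?cards1 //.
  by apply/setP=> x; rewrite !inE; apply/eqP/eqP=> [/anisoQ0|->] //; exact: quad0.
apply: etrans (card_level_isometric 0 (isometric_hyps_osumq m Q0)) _.
rewrite [LHS](card_zeros_hyp (Q m)) IH muln2 -addnn -addnA expnD.
have arith (r : nat) : (1 < r)%N ->
    (r * ((r ^ m - 1) * (r ^ (m + k).-1 + 1)).+1 + r.-1 * (r ^ m * r ^ (m + k)) =
     ((r ^ m.+1 - 1) * (r ^ (m.+1 + k).-1 + 1)).+1)%N.
  move=> r1; have [mk|] := posnP (m + k).
    have [-> ->] : m = 0%N /\ k = 0%N by lia.
    by rewrite /= !expn0 !expn1; lia.
  rewrite addSn; case: (m + k)%N => // j _; rewrite /= !expnS.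
  have := expn_gt0 r m; rewrite (ltnW r1) /=.
  case: r r1 => // r _; case: (r.+1 ^ m)%N => // M _.
  have -> : (r.+1 * M.+1 - 1 = r.+1 * M + r)%N by lia.
  by rewrite subn1 /=; ring.
exact: arith.
Qed.

(** One factor for each hyperbolic plane that is split off. *)
Lemma card_orth_witt m :
  #|isoms (unary (Q m))| =
  (#|isoms (unary Q0)| * \prod_(1 <= i < m.+1)
     ((q ^ i - 1) * (q ^ (i + k).-1 + 1) * q ^ (i.-1 * 2 + k)))%N.
Proof.
elim: m => [|m IH].
  by rewrite big_geq // muln1 (card_isoms (isometric_hyps0_osumq Q0)).
rewrite (card_isoms (isometric_hyps_osumq m Q0)) card_orth_hyp; last first.
  exact: quadratic_hyps.
rewrite -[zeros _]/[set x | _ == _] -(card_level_isometric _ (isometric_hyps_osumq m Q0)).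
rewrite [#|_|](card_zeros_witt m.+1) IH [in RHS]big_nat_recr //=.
ring.
Qed.

End Orders.

Lemma card_orth_plus m (Q0 : 'rV[F]_0 -> F) : quadratic Q0 -> (0 < m)%N ->
  #|isoms (unary (osumq (@hyps m) Q0))| =
  (2 * q ^ (m * (m - 1)) * (q ^ m - 1) * \prod_(1 <= k < m) (q ^ (2 * k) - 1))%N.
Proof.
move=> q0 m0; have a0 : anisotropic Q0 by move=> x _; exact: thinmx0.
by rewrite card_orth_witt // card_isoms_dim0 mul1n prod_orders0.
Qed.

Lemma card_orth_minus m (Q0 : 'rV[F]_2 -> F) : quadratic Q0 -> anisotropic Q0 ->
  #|isoms (unary (osumq (@hyps m) Q0))| =
  (2 * q ^ (m.+1 * m) * (q ^ m.+1 + 1)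
   * \prod_(1 <= k < m.+1) (q ^ (2 * k) - 1))%N.
Proof.
move=> q0 a0; rewrite card_orth_witt // card_orth_aniso_plane // -[q.+1]addn1 -mulnA.
by rewrite prod_orders2; ring.
Qed.

Lemma card_orth_odd m (Q0 : 'rV[F]_1 -> F) : 2%:R != 0 :> F ->
  quadratic Q0 -> anisotropic Q0 ->
  #|isoms (unary (osumq (@hyps m) Q0))| =
  (2 * q ^ (m ^ 2) * \prod_(1 <= k < m.+1) (q ^ (2 * k) - 1))%N.
Proof.
move=> F2 q0 a0; rewrite card_orth_witt // card_orth_line //.
by rewrite prod_orders1; ring.
Qed.
End WittDecomposition.

(** * Symplectic groups *)

Section Symplectic.
Variable F : finFieldType.
Implicit Types (a b c t : F).
Local Notation q := #|F|.

Definition symplectic n (B : 'rV[F]_n -> 'rV[F]_n -> F) : Prop :=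
  [/\ forall x, functional (B x), forall y, functional (B^~ y),
      forall x, B x x = 0 & forall x, (forall y, B x y = 0) -> x = 0].

Section Theory.
Variables (n : nat) (B : 'rV[F]_n -> 'rV[F]_n -> F).
Hypothesis sympB : symplectic B.

Let Bxx x : B x x = 0. Proof. by have [_ _ -> _] := sympB. Qed.

Lemma sympDr x y z : B x (y + z) = B x y + B x z.
Proof.
by have [fr _ _ _] := sympB; rewrite -[y]scale1r fr scale1r mul1r.
Qed.

Lemma symp0r x : B x 0 = 0.
Proof. by apply: (addrI (B x 0)); rewrite -sympDr !addr0. Qed.

Lemma sympZr x a y : B x (a *: y) = a * B x y.
Proof.
by have [fr _ _ _] := sympB; rewrite -[a *: y]addr0 fr symp0r addr0.
Qed.

Lemma sympDl x y z : B (y + z) x = B y x + B z x.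
Proof.
by have [_ fl _ _] := sympB; rewrite -[y]scale1r fl scale1r mul1r.
Qed.

Lemma sympC x y : B y x = - B x y.
Proof.
apply/eqP; rewrite -addr_eq0; have := Bxx (x + y).
by rewrite sympDr !sympDl !Bxx add0r addr0 => ->.
Qed.

Lemma sympZl x a y : B (a *: y) x = a * B y x.
Proof. by rewrite !(sympC x) sympZr mulrN. Qed.

Lemma sympNr x y : B x (- y) = - B x y.
Proof. by rewrite -scaleN1r sympZr mulN1r. Qed.

Lemma sympNl x y : B (- y) x = - B y x.
Proof. by rewrite -scaleN1r sympZl mulN1r. Qed.

Definition sympE := (sympDr, sympDl, sympNr, sympNl, sympZr, sympZl, symp0r).

Lemma symp_neq0 x : x != 0 -> exists y, B x y != 0.
Proof.
move=> x0; case: (pickP (fun y => B x y != 0)) => [y By|Bx0]; first by exists y.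
have [_ _ _ nd] := sympB.
by case/eqP: x0; apply: nd => y; apply/eqP/negPn; rewrite Bx0.
Qed.

Lemma transvection_symp t v :
  exists2 g : {perm 'rV[F]_n}, g \in isoms B &
    forall x, g x = x + (t * B x v) *: v.
Proof.
pose f x := x + (t * B x v) *: v.
have fB x y : B (f x) (f y) = B x y.
  by rewrite /f !sympE Bxx (sympC y v); ring.
have lf : linear f.
  by move=> a x y; rewrite /f !sympE; apply/rowP=> i; rewrite !mxE; ring.
have [_ fD fN _] := linear_comb lf.
apply: (isoms_of lf _ fB) => x y fxy; apply/eqP; rewrite -subr_eq0.
apply/eqP; have [_ _ _ nd] := sympB; apply: nd => z.
by rewrite -fB fD fN fxy subrr sympC symp0r oppr0.
Qed.

(** The transvection along [y - x] that moves [x] to [y]. *)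
Lemma transvection_trans x y : B x y != 0 ->
  exists2 g : {perm 'rV[F]_n}, g \in isoms B &
    g x = y /\ forall z, B z x = B z y -> g z = z.
Proof.
move=> Bxy; have [g Og gE] := transvection_symp (B x y)^-1 (y - x).
exists g => //; split=> [|z Bz]; rewrite gE !sympE.
  by rewrite Bxx subr0 mulVf // scale1r addrC subrK.
by rewrite Bz subrr mulr0 scale0r addr0.
Qed.

Lemma symp_trans x y : x != 0 -> y != 0 ->
  exists2 g : {perm 'rV[F]_n}, g \in isoms B & g x = y.
Proof.
move=> x0 y0; case: (eqVneq (B x y) 0) => [Bxy|/transvection_trans[g Og []]].
  have [u Bxu] := symp_neq0 x0; have [v Byv] := symp_neq0 y0.
  have [w Bxw Byw] : exists2 w, B x w != 0 & B y w != 0.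
    case: (eqVneq (B y u) 0) => [Byu|Byu]; last by exists u.
    case: (eqVneq (B x v) 0) => [Bxv|Bxv]; last by exists v.
    by exists (u + v); rewrite sympDr ?Byu ?Bxv ?addr0 ?add0r.
  have [g Og [gx _]] := transvection_trans Bxw.
  have [|h Oh [hw _]] := @transvection_trans w y; first by rewrite sympC oppr_eq0.
  by exists (g * h)%g; [exact: (groupM (G := isoms_group B))|rewrite permM gx].
by exists g.
Qed.

(** The transvection moving [y] to [z] fixes [x] because [z - y] is orthogonal
    to [x]. *)
Lemma symp_pair_trans x y z : B x y = 1 -> B x z = 1 ->
  exists2 g : {perm 'rV[F]_n}, g \in isoms B & g x = x /\ g y = z.
Proof.
move=> Bxy Bxz; case: (eqVneq (B y z) 0) => [Byz|/transvection_trans[g Og [gy gx]]].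
  (* [y + x] is another partner of [x], orthogonal to neither [y] nor [z]. *)
  have [|g Og [gy gx]] := @transvection_trans y (y + x).
    by rewrite !sympE Bxx add0r (sympC x) oppr_eq0 Bxy oner_eq0.
  have [|h Oh [hy hx]] := @transvection_trans (y + x) z.
    by rewrite !sympE Byz Bxz add0r oner_eq0.
  exists (g * h)%g; first exact: (groupM (G := isoms_group B)).
  rewrite !permM gy gx; last by rewrite !sympE Bxx addr0.
  by rewrite hx // !sympE Bxx addr0 Bxy.
by exists g => //; split=> //; apply: gx; rewrite Bxy.
Qed.

End Theory.

Definition hypb (x y : 'rV[F]_2) : F := x 0 0 * y 0 1 - x 0 1 * y 0 0.

Section Split.
Variables (n : nat) (B : 'rV[F]_n -> 'rV[F]_n -> F).
Hypothesis sympB : symplectic B.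
Local Notation HB := (osum hypb B).

Lemma symplectic_hypb_osum : symplectic HB.
Proof.
have [fr fl Bxx nd] := sympB; split=> [x a y z|y a x z|x|x Bx].
- by rewrite /osum /hypb !linearP /= fr !mxE; ring.
- by rewrite /osum /hypb !linearP /= fl !mxE; ring.
- by rewrite /osum /hypb Bxx; ring.
- rewrite -[x]hsubmxK; apply/eqP; rewrite row_mx_eq0; apply/andP; split.
    have := Bx (row_mx (row2 0 1) 0); have := Bx (row_mx (row2 1 0) 0).
    rewrite /osum !row_mxKl !row_mxKr (symp0r sympB) /hypb !row2E.
    rewrite !mulr0 !mulr1 !addr0 subr0 sub0r => /eqP; rewrite oppr_eq0 => /eqP x1 x0.
    by rewrite [lsubmx x]row2_eta row2_eq0 x0 x1 eqxx.
  apply/eqP/nd => y; have := Bx (row_mx 0 y).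
  by rewrite /osum row_mxKl row_mxKr /hypb !mxE !mulr0 subrr add0r.
Qed.

(** The same count as for quadratic forms, with all nonzero vectors in the role
    of the singular ones and the [(a, 1, w)] in that of the partners. *)
Lemma card_isoms_hypb :
  #|isoms HB| = ((q ^ (2 + n)).-1 * q ^ n.+1 * #|isoms B|)%N.
Proof.
have sympHB := symplectic_hypb_osum.
pose e : 'rV[F]_(2 + n) := row_mx (row2 1 0) 0.
pose f : 'rV[F]_(2 + n) := row_mx (row2 0 1) 0.
have B0l w : B 0 w = 0 by rewrite (sympC sympB w) (symp0r sympB) oppr0.
have BeE x : HB e x = lsubmx x 0 1.
  by rewrite /osum !row_mxKl !row_mxKr B0l /hypb !row2E; ring.
have BfE x : HB f x = - lsubmx x 0 0.
  by rewrite /osum !row_mxKl !row_mxKr B0l /hypb !row2E; ring.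
have e0 : e != 0 by rewrite row_mx_eq0 row2_eq0 oner_eq0.
pose G := isoms_group HB.
rewrite (card_orbit_fix (G := G) (x := e) (X := [set~ 0])); last first.
  move=> y; rewrite !inE; split=> [y0|[g Gg <-]].
    exact: (symp_trans sympHB).
  have /isomsP[lg sg] := Gg; have [g0 _ _ _] := linear_comb lg.
  by apply: contra_neq e0 => ge0; apply: (@perm_inj _ g); rewrite ge0 g0.
rewrite cardsC1 card_mx mul1n -mulnA; congr (_ * _)%N.
pose Y := [set row_mx (row2 u.1 1) u.2 | u in [set: F * 'rV[F]_n]].
rewrite (card_orbit_fix (G := 'C_G[e | 'P]%G) (x := f) (X := Y)); last first.
  move=> y; split=> [/imsetP[u _ ->]|[g]].
    have [||g Gg [ge gf]] := @symp_pair_trans _ _ sympHB e f (row_mx (row2 u.1 1) u.2).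
    - by rewrite BeE row_mxKl row2E.
    - by rewrite BeE row_mxKl row2E.
    by exists g => //; rewrite mem_stab ge eqxx andbT.
  rewrite mem_stab => /andP[Gg /eqP ge] <-; have /isomsP[_ sg] := Gg.
  have Bgf : lsubmx (g f) 0 1 = 1.
    by rewrite -BeE -{1}ge sg BeE row_mxKl row2E.
  apply/imsetP; exists (lsubmx (g f) 0 0, rsubmx (g f)) => //.
  by rewrite -[LHS]hsubmxK [lsubmx (g f) in LHS]row2_eta Bgf.
rewrite card_imset; last first.
  move=> [a w] [b v] /eq_row_mx[/(congr1 (fun x : 'rV_2 => x 0 0))].
  by rewrite !row2E /= => -> ->.
rewrite cardsT card_prod card_mx mul1n -expnS; congr (_ * _)%N.
apply: (@card_isoms_fix_left _ _ 2 n hypb).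
  move=> g; rewrite !mem_stab -andbA; split.
    case/and3P=> Gg /eqP ge /eqP gf; split=> // a.
    have /isomsP[lg _] := Gg; have [_ gD _ gZ] := linear_comb lg.
    by rewrite row2_basis gD !gZ ge gf.
  by case=> Gg fixg; rewrite [g \in _]Gg !fixg !eqxx.
move=> g; rewrite !mem_stab -andbA => /and3P[Gg /eqP ge /eqP gf] w.
have /isomsP[_ sg] := Gg.
rewrite [LHS]row2_eta; apply/eqP; rewrite row2_eq0 -BeE -oppr_eq0 -BfE.
by rewrite -{1}ge -{1}gf !sg BeE BfE row_mxKl !mxE oppr0 eqxx.
Qed.

End Split.

Lemma split_symplectic n (B : 'rV[F]_n.+1 -> 'rV[F]_n.+1 -> F) : symplectic B ->
  exists r (B' : 'rV[F]_r -> 'rV[F]_r -> F), symplectic B' /\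
    isometric (osum hypb B') B.
Proof.
move=> sB; have [x x0] := @exists_neq0 F n.+1 isT.
have [fr fl Bxx nd] := sB; have [y0 By0] := symp_neq0 sB x0.
have [y Bxy] : exists y, B x y = 1.
  by exists ((B x y0)^-1 *: y0); rewrite (sympZr sB) mulVf.
have [||||||r [psi [lpsi orth bpsi]]] := @split_plane _ _ (B^~ y) (B x) x y => //.
have [p0 pD pN pZ] := linear_comb lpsi.
have [phi phiK Kphi] := bpsi.
have orth' w : B (psi w) x = 0 by rewrite (sympC sB x) (orth w).2 oppr0.
exists r, (fun w w' => B (psi w) (psi w')); split.
  split=> [w a w1 w2|w a w1 w2|w|w Bw].
  - by rewrite pD pZ fr.
  - by rewrite pD pZ fl.
  - exact: Bxx.
  - have psiw : psi w = 0.
      apply: nd => v; rewrite -[v]Kphi !(sympDr sB) !(sympZr sB) Bw.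
      by rewrite orth' (orth w).1; ring.
    have := phiK (row_mx 0 w); have := phiK 0.
    rewrite row_mxKl row_mxKr !linear0 !mxE psiw p0 !scale0r !addr0 => -> /eqP.
    by rewrite eq_sym row_mx_eq0 => /andP[_ /eqP].
exists (fun z : 'rV[F]_(2 + r) =>
  lsubmx z 0 0 *: x + lsubmx z 0 1 *: y + psi (rsubmx z)).
split=> // [a z1 z2|z z'].
  rewrite !linearP /= lpsi; apply/rowP=> i; rewrite !mxE; ring.
rewrite /osum /hypb /= !(sympDr sB) !(sympDl sB) !(sympZr sB) !(sympZl sB).
rewrite !Bxx !orth' !(orth _).2 !(orth _).1 (sympC sB x y) Bxy.
by rewrite (sympC sB (psi _) y) (orth _).1; ring.
Qed.

Theorem card_symplectic n (B : 'rV[F]_n -> 'rV[F]_n -> F) : symplectic B ->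
  exists2 m, n = (m * 2)%N &
    #|isoms B| = (q ^ (m ^ 2) * \prod_(1 <= k < m.+1) (q ^ (2 * k) - 1))%N.
Proof.
elim/ltn_ind: n B => -[_ B _|n IH B sB].
  by exists 0%N; rewrite // big_geq // muln1; exact: card_isoms_dim0.
have [r [B' [sB' iso]]] := split_symplectic sB.
have dimr := isometric_dim iso.
have [m rm cB'] := IH r ltac:(lia) B' sB'; exists m.+1; first by rewrite -dimr rm mulSn.
rewrite -(card_isoms iso) card_isoms_hypb // cB' [in RHS]big_nat_recr //= rm.
have -> : (2 + m * 2 = 2 * m.+1)%N by lia.
have -> : (m.+1 ^ 2 = m ^ 2 + (m * 2).+1)%N by rewrite -!mulnn; lia.
by rewrite expnD -subn1; ring.
Qed.

End Symplectic.

(** * The p-torsion of Q/pZ *)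

Section Values.
Variable p : nat.
Hypothesis p_pr : prime p.

Lemma toQmodZD r s : toQmodZ p (r + s) = toQmodZ p r + toQmodZ p s.
Proof. exact: raddfD. Qed.

Lemma toQmodZ0 : toQmodZ p 0 = 0.
Proof. exact: raddf0. Qed.

Lemma toQmodZ_onto (z : QmodZ p) : exists r, z = toQmodZ p r.
Proof. by exists (generic_quotient.repr z); rewrite /toQmodZ generic_quotient.reprK. Qed.

(** By [embD], [emb_inj] and [emb_torsion], this identifies Z/pZ with the
    p-torsion of Q/pZ, so that it carries forms with values in one to forms with
    values in the other. *)
Definition emb (a : 'F_p) : QmodZ p := toQmodZ p (a : nat)%:R.

Lemma toQmodZ_int (k : int) : toQmodZ p k%:~R = emb k%:~R.
Proof.
have p0 : p%:R != 0 :> rat by rewrite pnatr_eq0 -lt0n prime_gt0.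
pose x : 'rV['F_p]_1 := const_mx k%:~R.
have [|l] := @coord_ratE p 1 x 0 k p_pr; first by rewrite mxE.
rewrite /coord_rat mxE => E; apply/eqP.
rewrite /emb eq_toQmodZ E opprD addrA subrr add0r mulNr mulfK // rpredN.
exact: intr_int.
Qed.

Lemma emb_int (a : 'F_p) : exists k : int, a = k%:~R.
Proof. by exists (a : nat)%:Z; rewrite -pmulrn natr_Zp. Qed.

Lemma embD a b : emb (a + b) = emb a + emb b.
Proof.
have [k ->] := emb_int a; have [l ->] := emb_int b.
by rewrite -rmorphD /= -!toQmodZ_int rmorphD /= toQmodZD.
Qed.

Lemma emb0 : emb 0 = 0.
Proof. by apply: (addrI (emb 0)); rewrite -embD !addr0. Qed.

Lemma embN a : emb (- a) = - emb a.
Proof. by apply: (addrI (emb a)); rewrite -embD !subrr emb0. Qed.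

Lemma embB a b : emb (a - b) = emb a - emb b.
Proof. by rewrite embD embN. Qed.

Lemma emb_inj : injective emb.
Proof.
have p0 : p%:R != 0 :> rat by rewrite pnatr_eq0 -lt0n prime_gt0.
move=> a b /eqP; rewrite -subr_eq0 -embB; have [k abk] := emb_int (a - b).
rewrite abk -toQmodZ_int -toQmodZ0 eq_toQmodZ subr0 => /intrP[l kl].
apply/eqP; rewrite -subr_eq0 abk -(dvdz_pcharf (pchar_Fp p_pr)).
apply/dvdzP; exists l; apply: (@intr_inj rat).
by rewrite rmorphM /= -kl divfK.
Qed.

Lemma emb_torsion z : z *+ p = 0 -> exists a, z = emb a.
Proof.
have p0 : p%:R != 0 :> rat by rewrite pnatr_eq0 -lt0n prime_gt0.
have [r ->] := toQmodZ_onto z.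
have toMn n : toQmodZ p r *+ n = toQmodZ p (r *+ n).
  elim: n => [|n IH]; first by rewrite !mulr0n toQmodZ0.
  by rewrite !mulrS toQmodZD IH.
rewrite toMn -toQmodZ0 => /eqP; rewrite eq_toQmodZ subr0 -[r *+ p]mulr_natr mulfK //.
by case/intrP=> k ->; exists k%:~R; rewrite toQmodZ_int.
Qed.

End Values.

(** * Odd bilinear forms over the field with two elements *)

Section CharacteristicVector.
Local Notation F := 'F_2.

Lemma F2_cases (a : F) : a = 0 \/ a = 1.
Proof. by case: a => [[|[|]]] // i; [left|right]; apply: val_inj. Qed.

Lemma F2_sqr (a : F) : a * a = a.
Proof. by case: (F2_cases a) => ->; rewrite ?mulr0 ?mulr1. Qed.

Lemma F2_addrr (a : F) : a + a = 0.
Proof. by case: (F2_cases a) => ->; apply: val_inj. Qed.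

Lemma F2_oppr (a : F) : - a = a.
Proof. by case: (F2_cases a) => ->; apply: val_inj. Qed.

(** A form [beta] determines its characteristic vector [c], defined by
    [beta x x = beta x c], so its isometries fix [c]. *)
Lemma characteristic_fixed n (beta : 'rV[F]_n -> 'rV[F]_n -> F) c
    (f : {perm 'rV[F]_n}) :
  (forall u v, (forall z, beta z u = beta z v) -> u = v) ->
  (forall x, beta x x = beta x c) ->
  (forall x y, beta (f x) (f y) = beta x y) -> f c = c.
Proof.
move=> sep cE fb; apply: sep => z; rewrite -[z](permKV f).
by rewrite fb -cE -cE fb.
Qed.

Definition dot k (x y : 'rV[F]_k) : F := \sum_i x 0 i * y 0 i.

Lemma dot_ones k (x : 'rV[F]_k) : dot x x = dot x (const_mx 1).
Proof. by apply: eq_bigr => i _; rewrite mxE mulr1 F2_sqr. Qed.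

Lemma dot_delta k (x : 'rV[F]_k) i : dot (delta_mx 0 i) x = x 0 i.
Proof.
rewrite /dot (bigD1 i) //= mxE !eqxx mul1r big1 ?addr0 // => j ji.
by rewrite mxE eqxx (negbTE ji) mul0r.
Qed.

Lemma dot0 k (x : 'rV[F]_k) : dot x 0 = 0.
Proof. by rewrite /dot big1 // => i _; rewrite mxE mulr0. Qed.

Section Sum.
Variables (k n : nat) (B : 'rV[F]_n -> 'rV[F]_n -> F).
Hypothesis sympB : symplectic B.
Local Notation beta := (osum (@dot k) B).
Local Notation c := (row_mx (const_mx 1) 0 : 'rV[F]_(k + n)).

Lemma osum_dot_left a x : beta (row_mx a 0) x = dot a (lsubmx x).
Proof.
by rewrite /osum row_mxKl row_mxKr (sympC sympB) (symp0r sympB) oppr0 addr0.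
Qed.

Lemma osum_dot_sep (u v : 'rV[F]_(k + n)) :
  (forall z, beta z u = beta z v) -> u = v.
Proof.
move=> uv; rewrite -[u]hsubmxK -[v]hsubmxK; congr row_mx.
  apply/rowP=> i; have := uv (row_mx (delta_mx 0 i) 0).
  by rewrite !osum_dot_left !dot_delta.
have [_ _ _ nd] := sympB.
apply/eqP; rewrite -subr_eq0; apply/eqP/nd => y; rewrite (sympC sympB y).
rewrite (sympDr sympB) (sympNr sympB); have := uv (row_mx 0 y).
have dot0l w : dot (0 : 'rV[F]_k) w = 0.
  by rewrite /dot big1 // => i _; rewrite mxE mul0r.
by rewrite /osum !row_mxKl !row_mxKr !dot0l !add0r => ->; rewrite subrr oppr0.
Qed.

Lemma osum_dot_ones x : beta x x = beta x c.
Proof.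
have [_ _ Bxx _] := sympB.
by rewrite /osum row_mxKl row_mxKr Bxx (symp0r sympB) dot_ones.
Qed.

Lemma osum_dot_fixed (f : {perm 'rV[F]_(k + n)}) :
  (forall x y, beta (f x) (f y) = beta x y) -> f c = c.
Proof. exact: characteristic_fixed osum_dot_sep osum_dot_ones. Qed.

Lemma osum_dot_stable (f : {perm 'rV[F]_(k + n)}) :
  (forall x y, beta (f x) (f y) = beta x y) ->
  (forall a, f (row_mx a 0) = row_mx a 0) ->
  forall w, lsubmx (f (row_mx 0 w)) = 0.
Proof.
move=> fb fixf w; apply/rowP=> i; rewrite [RHS]mxE -dot_delta -osum_dot_left.
by rewrite -{1}fixf fb osum_dot_left row_mxKl dot0.
Qed.

End Sum.

Section OneLine.
Variables (T : zmodType) (n : nat) (B : 'rV[F]_n -> 'rV[F]_n -> F).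
Variables (s1 : 'rV[F]_1 -> 'rV[F]_1 -> T) (s2 : 'rV[F]_n -> 'rV[F]_n -> T).
Hypothesis sympB : symplectic B.
Hypothesis preserved : forall f : {perm 'rV[F]_(1 + n)},
  f \in isoms (osum s1 s2) ->
  forall x y, osum (@dot 1) B (f x) (f y) = osum (@dot 1) B x y.

(** The line is spanned by the characteristic vector. *)
Lemma card_isoms_line : #|isoms (osum s1 s2)| = #|isoms s2|.
Proof.
have fixed f : f \in isoms (osum s1 s2) -> forall a, f (row_mx a 0) = row_mx a 0.
  move=> If a; have /isomsP[lf _] := If; have [_ _ _ fZ] := linear_comb lf.
  have -> : row_mx a 0 = a 0 0 *: row_mx (const_mx 1) 0 :> 'rV[F]_(1 + n).
    rewrite scale_row_mx scaler0; congr row_mx.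
    by apply/rowP=> i; rewrite !mxE !ord1 mulr1.
  by rewrite fZ (osum_dot_fixed sympB (preserved If)).
apply: (@card_isoms_fix_left _ _ 1 n s1) => [f|f If].
  by split=> [If|[]//]; split=> //; apply: fixed.
exact: osum_dot_stable (preserved If) (fixed f If).
Qed.

End OneLine.

Section Plane.
Variables (n : nat) (B : 'rV[F]_n -> 'rV[F]_n -> F).
Hypothesis sympB : symplectic B.
Local Notation V := 'rV[F]_(2 + n).
Local Notation beta := (osum (@dot 2) B).
Local Notation d := (row_mx (row2 1 0) 0 : V).

Lemma dotE2 (x y : 'rV[F]_2) : dot x y = x 0 0 * y 0 0 + x 0 1 * y 0 1.
Proof.
rewrite /dot big_ord_recl big_ord1; congr (_ * _ + _ * _); congr (_ 0 _);
exact: val_inj.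
Qed.

(** An isometry fixing [d] fixes the whole plane, which [d] and the
    characteristic vector span; so only the orbit of [d] remains to be
    found. *)
Lemma card_isoms_plane (T : zmodType) (s1 : 'rV[F]_2 -> 'rV[F]_2 -> T)
    (s2 : 'rV[F]_n -> 'rV[F]_n -> T) (X : {set V}) :
  (forall f : {perm V}, f \in isoms (osum s1 s2) ->
    forall x y, beta (f x) (f y) = beta x y) ->
  (forall y, y \in X <-> exists2 f, f \in isoms (osum s1 s2) & f d = y) ->
  #|isoms (osum s1 s2)| = (#|X| * #|isoms s2|)%N.
Proof.
move=> preserved defX; pose G := isoms_group (osum s1 s2).
rewrite (card_orbit_fix (G := G) defX); congr (_ * _)%N.
have fixed f : f \in 'C_G[d | 'P]%g -> forall a, f (row_mx a 0) = row_mx a 0.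
  rewrite mem_stab => /andP[If /eqP fd] a.
  have /isomsP[lf _] := If; have [_ fD _ fZ] := linear_comb lf.
  pose c : V := row_mx (const_mx 1) 0.
  have fc : f c = c := osum_dot_fixed sympB (preserved f If).
  have -> : row_mx a 0 = (a 0 0 - a 0 1) *: d + a 0 1 *: c.
    rewrite !scale_row_mx add_row_mx !scaler0 addr0; congr row_mx.
    rewrite [LHS]row2_eta; apply/rowP=> i; rewrite !mxE.
    by case: ifP => _; ring.
  by rewrite fD !fZ fd fc.
apply: (@card_isoms_fix_left _ _ 2 n s1) => [f|f Cf].
  split=> [Cf|[If fixf]]; last by rewrite mem_stab [f \in _]If fixf eqxx.
  by split; [move: Cf; rewrite mem_stab => /andP[]|exact: fixed].
have If : f \in isoms (osum s1 s2) by move: Cf; rewrite mem_stab => /andP[].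
exact: osum_dot_stable sympB _ (preserved f If) (fixed f Cf).
Qed.

(** The plane on the left has basis [d = (1, 0)] and the characteristic vector
    [c = (1, 1)]. The general isometry of [beta] fixes [c], sends [d] to some
    [v + d + mu c], and sends a vector [x] of the right summand to
    [g x + B (g x) v c], the coefficient of [c] being dictated by orthogonality
    to the image of [d]. *)
Definition shear (g : 'rV[F]_n -> 'rV[F]_n) v mu (x : V) : V :=
  let sg := lsubmx x 0 0 + lsubmx x 0 1 in
  row_mx (lsubmx x + (sg * mu + B (g (rsubmx x)) v) *: const_mx 1)
         (g (rsubmx x) + sg *: v).

Lemma shear_isom g v mu : linear g -> (forall x y, B (g x) (g y) = B x y) ->
  exists2 f : {perm V}, f \in isoms beta & f =1 shear g v mu.
Proof.
move=> lg gB; have [_ _ Bxx _] := sympB.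
have lf : linear (shear g v mu).
  move=> a x y; rewrite /shear !linearP /= lg scale_row_mx add_row_mx.
  congr row_mx; apply/rowP=> i; rewrite !mxE ?(sympDl sympB) ?(sympZl sympB); ring.
have fB x y : beta (shear g v mu x) (shear g v mu y) = beta x y.
  rewrite /osum /shear !row_mxKl !row_mxKr !dotE2 !mxE.
  rewrite !(sympDl sympB) !(sympDr sympB) !(sympZl sympB) !(sympZr sympB) Bxx gB.
  rewrite (sympC sympB (g (rsubmx y)) v) F2_oppr.
  set b := B (g (rsubmx x)) v; set b' := B (g (rsubmx y)) v.
  set B0 := B _ _; set x0 := x 0 (lshift n 0); set x1 := x 0 (lshift n 1).
  set y0 := y 0 (lshift n 0); set y1 := y 0 (lshift n 1).
  have -> : x0 * y0 + x1 * y1 + B0 = x0 * y0 + x1 * y1 + B0 +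
    (((x0 + x1) * mu + b) * ((y0 + y1) * mu + b') +
     (x0 + x1) * (y0 + y1) * mu + (x0 + x1) * b' + (y0 + y1) * b) * (1 + 1).
    by rewrite F2_addrr mulr0 addr0.
  by ring.
apply: (isoms_of lf _ fB) => x y fxy; apply: (osum_dot_sep sympB) => z.
by rewrite -fB fxy fB.
Qed.

Lemma plane_image_d (f : {perm V}) :
  (forall x y, beta (f x) (f y) = beta x y) ->
  lsubmx (f d) 0 0 = 1 + lsubmx (f d) 0 1.
Proof.
move=> fb; have := fb d d; have [_ _ Bxx _] := sympB.
rewrite /osum !Bxx !addr0 !dotE2 !F2_sqr row_mxKl !row2E addr0 => ab.
by apply: (addIr (lsubmx (f d) 0 1)); rewrite ab -addrA F2_addrr addr0.
Qed.

Lemma shear_d (g : 'rV[F]_n -> 'rV[F]_n) v mu : linear g ->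
  shear g v mu d = row_mx (row2 (1 + mu) mu) v.
Proof.
move=> lg; have [g0 _ _ _] := linear_comb lg.
rewrite /shear row_mxKl row_mxKr g0 !row2E addr0 scale1r add0r.
rewrite (sympC sympB v 0) (symp0r sympB) oppr0 addr0 mul1r.
congr row_mx; apply/rowP=> i; rewrite !mxE mulr1.
by case: ifP; rewrite ?add0r.
Qed.

Theorem card_isoms_dot2 :
  #|isoms beta| = (2 ^ n.+1 * #|isoms B|)%N.
Proof.
pose Y : {set V} := [set row_mx (row2 (1 + u.1) u.1) u.2 | u in [set: F * 'rV[F]_n]].
have <- : #|Y| = (2 ^ n.+1)%N.
  rewrite card_imset ?cardsT ?card_prod ?card_mx ?card_Fp ?mul1n -?expnS //.
  move=> [a u] [b v] /eq_row_mx[/(congr1 (fun x : 'rV_2 => x 0 1))].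
  by rewrite !row2E /= => -> ->.
apply: card_isoms_plane => [f /isomsP[] //|y]; split.
  case/imsetP=> [[mu v] _ ->]; have lid : linear (@id 'rV[F]_n) by [].
  have [f If fE] := shear_isom v mu lid (fun _ _ => erefl).
  by exists f; rewrite // fE shear_d.
move=> [f If <-]; have /isomsP[_ fb] := If.
apply/imsetP; exists (lsubmx (f d) 0 1, rsubmx (f d)) => //.
by rewrite /= -[LHS]hsubmxK [lsubmx (f d) in LHS]row2_eta (plane_image_d fb).
Qed.

End Plane.
End CharacteristicVector.

(** * Odd quadratic forms over the field with two elements *)

Section HalfIntegral.
Local Notation F := 'F_2.
Local Notation T := (QmodZ 2).
Local Notation io := (@emb 2).
Let pr2 : prime 2 := isT.

Lemma quadratic_symplectic n (Q : 'rV[F]_n -> F) :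
  quadratic Q -> symplectic (polar Q).
Proof.
move=> qQ; split=> [x|y|x|x].
- exact: functional_polar.
- by move=> a x z; rewrite (polarDl qQ) (polarZl qQ).
- by rewrite (polarxx qQ) mulr_natl mulr2n F2_addrr.
- exact: polar_nondeg.
Qed.

(** The isometries of the polar form [B] permute the quadratic forms with polar
    form [B] and as many zeros as [Q], which are the [Q + B(., v)] with
    [Q v = 0]. The formulas for the three cardinals give the equality through
    [(2 ^ m - 1) * (2 ^ m + 1) = 2 ^ (2 * m) - 1], for both types of [Q]. *)
Lemma card_isoms_polar n (Q : 'rV[F]_n -> F) : quadratic Q ->
  #|isoms (polar Q)| = (#|zeros Q| * #|isoms (unary Q)|)%N.
Proof.
move=> qQ; have [m' nm' ->] := card_symplectic (quadratic_symplectic qQ).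
have [m [k [Q0 [q0 a0 k2 iso]]]] := witt_decomposition qQ.
have dimn := isometric_dim iso.
rewrite -(card_isoms iso) -[zeros Q](_ : [set x | Q x == 0] = _) //.
rewrite -(card_level_isometric 0 iso) -/(zeros _).
rewrite card_zeros_witt // card_Fp //.
case: k Q0 q0 a0 k2 iso dimn => [|[|[|]]] // Q0 q0 a0 _ iso dimn; first last.
- have -> : m' = m.+1 by lia.
  rewrite zeros_minus card_orth_minus // card_Fp // big_nat_recr //= -sqr_minus1.
  have -> : (m.+1 ^ 2 = m + m.+1 * m + 1)%N by rewrite -mulnn; lia.
  by rewrite !expnD; ring.
- by lia.
have -> : m' = m by lia.
case: (posnP m) => [->|m0].
  by rewrite card_orth_witt // card_isoms_dim0 !big_geq.
rewrite zeros_plus // card_orth_plus // card_Fp //.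
case: m m0 {Q0 q0 a0 iso dimn} => // m _.
rewrite big_nat_recr //= -sqr_minus1 [(m.+1 - 1)%N]subn1 /=.
have -> : (m.+1 ^ 2 = m + m.+1 * m + 1)%N by rewrite -mulnn; lia.
by rewrite !expnD; ring.
Qed.

Section Values.
Variable w : T.
Hypothesis w2 : w + w = io 1.

(** The value at [a] of the form on a line that takes the value [w] on its
    nonzero vector. The forms that matter have [w + w] equal to the class of 1,
    so that [w] is the class of 1/2 or 3/2 modulo 2. *)
Definition wv (w : T) (a : F) : T := w *+ a.

Lemma wv0 u : wv u 0 = 0. Proof. by []. Qed.
Lemma wv1 u : wv u 1 = u. Proof. by []. Qed.

Lemma emb11 : io 1 + io 1 = 0.
Proof. by rewrite -embD // F2_addrr emb0. Qed.

Lemma wDemb : w + io 1 = - w.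
Proof. by apply/eqP; rewrite -addr_eq0 addrAC w2 emb11. Qed.

Lemma wNDemb : - w + io 1 = w.
Proof. by rewrite -w2 addKr. Qed.

Lemma wvD a b : wv w (a + b) = wv w a + wv w b + io (a * b).
Proof.
case: (F2_cases a) => ->; case: (F2_cases b) => ->;
  rewrite ?F2_addrr ?(add0r, addr0, mulr0, mul0r, mulr1) ?wv0 ?wv1 ?emb0 //
          ?(add0r, addr0) //.
by rewrite w2 emb11.
Qed.

Let F2E := (F2_addrr, addr0, add0r, mulr0, mul0r, mulr1, mul1r).

Lemma wv_shear13 s t b z :
  wv w (s + ((s + t) * z + b)) + wv (- w) (t + ((s + t) * z + b))
  + io ((s + t) * (z + b)) = wv w s + wv (- w) t.
Proof.
case: (F2_cases s) => ->; case: (F2_cases t) => ->; case: (F2_cases b) => ->;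
  case: (F2_cases z) => ->; rewrite ?F2E ?wv0 ?wv1 ?emb0 // ?F2E ?subrr //;
  by rewrite ?wDemb ?wNDemb.
Qed.

Lemma wv_shear11 s t b mu :
  wv w (s + ((s + t) * mu + b)) + wv w (t + ((s + t) * mu + b))
  + io (b + (s + t) * b) = wv w s + wv w t.
Proof.
case: (F2_cases s) => ->; case: (F2_cases t) => ->; case: (F2_cases b) => ->;
  case: (F2_cases mu) => ->; rewrite ?F2E ?wv0 ?wv1 ?emb0 // ?F2E //;
  by rewrite ?w2 ?emb11.
Qed.

Lemma wv_d13 z mu : wv w (1 + mu) + wv (- w) mu + io z = w -> mu = z.
Proof.
case: (F2_cases mu) => ->; rewrite ?F2E ?wv0 ?wv1 ?add0r ?addr0.
  by move/(canRL (addKr _)); rewrite addNr -(emb0 pr2) => /(emb_inj pr2).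
by rewrite -[X in _ = X]wNDemb => /addrI/(emb_inj pr2).
Qed.

Lemma wv_d11 z mu : wv w (1 + mu) + wv w mu + io z = w -> z = 0.
Proof.
case: (F2_cases mu) => ->; rewrite ?F2E ?wv0 ?wv1 ?add0r ?addr0;
by move/(canRL (addKr _)); rewrite addNr -(emb0 pr2) => /(emb_inj pr2).
Qed.

End Values.

Lemma twice_opp (w : T) : w + w = io 1 -> - w + - w = io 1.
Proof.
by move=> w2; rewrite -opprD w2; apply/eqP; rewrite eq_sym -addr_eq0 emb11.
Qed.

Definition wsum w w' (x : 'rV[F]_2) : T := wv w (x 0 0) + wv w' (x 0 1).

Section Forms.
Variables (n : nat) (Q : 'rV[F]_n -> F) (w : T).
Hypotheses (quadQ : quadratic Q) (w2 : w + w = io 1).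
Let sympB := quadratic_symplectic quadQ.
Local Notation B := (polar Q).

(** Although the quadratic form takes half-integral values, its polar form is
    integral, and it is an orthogonal sum of a unit form and an alternating
    one. *)
Lemma preserved_polar k (s1 : 'rV[F]_k -> T) :
  (forall x y, s1 (x + y) = s1 x + s1 y + io (dot x y)) ->
  forall f : {perm 'rV[F]_(k + n)},
  f \in isoms (osum (unary s1) (unary (io \o Q))) ->
  forall x y, osum (@dot k) B (f x) (f y) = osum (@dot k) B x y.
Proof.
move=> s1D f /isomsP[lf sf] x y; have [_ fD _ _] := linear_comb lf.
pose s x := s1 (lsubmx x) + io (Q (rsubmx x)) : T.
have {}sf z : s (f z) = s z := sf z z.
have sD u v : s (u + v) = s u + s v + io (osum (@dot k) B u v).
  rewrite /s /osum !linearD /= s1D quadD !embD //.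
  by rewrite [LHS](AC (3*3) ((1*4)*(2*5)*(3*6))).
apply: (emb_inj pr2); apply: (addrI (s x + s y)).
by rewrite -sD -{1}[s x]sf -{1}[s y]sf -sD -fD sf.
Qed.

Lemma wvD_line (x y : 'rV[F]_1) :
  wv w ((x + y) 0 0) = wv w (x 0 0) + wv w (y 0 0) + io (dot x y).
Proof. by rewrite mxE wvD // /dot big_ord1. Qed.

Theorem card_orth_w :
  #|isoms (osum (unary (fun x : 'rV_1 => wv w (x 0 0))) (unary (io \o Q)))| =
  #|isoms (unary (io \o Q))|.
Proof. exact: card_isoms_line sympB (preserved_polar wvD_line). Qed.

Lemma wsumD w' : w' + w' = io 1 -> forall x y,
  wsum w w' (x + y) = wsum w w' x + wsum w w' y + io (dot x y).
Proof.
move=> w2' x y; rewrite /wsum !mxE !wvD // dotE2 embD //.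
by rewrite [LHS](AC (3*3) ((1*4)*(2*5)*(3*6))).
Qed.

Local Notation V := 'rV[F]_(2 + n).
Local Notation d := (row_mx (row2 1 0) 0 : V).

Lemma rowE2 (x : V) :
  x = row_mx (row2 (lsubmx x 0 0) (lsubmx x 0 1)) (rsubmx x).
Proof. by rewrite -row2_eta hsubmxK. Qed.

Lemma quad_shear g v mu (x : V) :
  Q (rsubmx (shear B g v mu x)) =
  Q (g (rsubmx x)) + (lsubmx x 0 0 + lsubmx x 0 1) * (Q v + B (g (rsubmx x)) v).
Proof.
rewrite /shear row_mxKr (quadD Q) (quadZ quadQ) (polarZr quadQ) expr2 F2_sqr.
by ring.
Qed.

Lemma wsum_shear w' g v mu (x : V)
    (k := (lsubmx x 0 0 + lsubmx x 0 1) * mu + B (g (rsubmx x)) v) :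
  wsum w w' (lsubmx (shear B g v mu x)) =
  wv w (lsubmx x 0 0 + k) + wv w' (lsubmx x 0 1 + k).
Proof.
rewrite /wsum /shear row_mxKl; congr (wv _ _ + wv _ _).
  by rewrite mxE [X in _ + X]mxE [X in _ * X]mxE mulr1.
by rewrite mxE [X in _ + X]mxE [X in _ * X]mxE mulr1.
Qed.

(** The candidates for the orbit of [d] are the [v + d + mu c] on which the
    quadratic form takes the same value as on [d]; those in [Y] are reached by
    shears that preserve the quadratic form. *)
Lemma card_orth_plane w' (Y : {set V}) : w' + w' = io 1 ->
  (forall y, y \in Y -> exists g v mu,
     [/\ linear g, forall x y, B (g x) (g y) = B x y, shear B g v mu d = y &
      forall x, wsum w w' (lsubmx (shear B g v mu x))
                + io (Q (rsubmx (shear B g v mu x)))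
                = wsum w w' (lsubmx x) + io (Q (rsubmx x))]) ->
  (forall v mu, wv w (1 + mu) + wv w' mu + io (Q v) = w ->
     row_mx (row2 (1 + mu) mu) v \in Y) ->
  #|isoms (osum (unary (wsum w w')) (unary (io \o Q)))| =
  (#|Y| * #|isoms (unary (io \o Q))|)%N.
Proof.
move=> w2' inY onY; have pres := preserved_polar (wsumD w2').
apply: (card_isoms_plane sympB pres) => y; split=> [/inY|[f If <-]].
  move=> [g [v [mu [lg gB dy qE]]]].
  have [f /isomsP[lf _] fE] := shear_isom sympB v mu lg gB.
  exists f; last by rewrite fE.
  by apply/isomsP; split=> // x z; rewrite !fE; exact: qE.
have fd := plane_image_d sympB (pres f If); have /isomsP[_ /(_ d d)] := If.
rewrite [f d]rowE2 fd; set mu := lsubmx _ _ _; set v := rsubmx _.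
rewrite /osum /unary /wsum /= !row_mxKl !row_mxKr !row2E wv0 wv1.
by rewrite (quad0 quadQ) emb0 // !addr0 => /onY.
Qed.

(** The characteristic vector [c] is singular, since [w] and [- w] add up to 0.
    The image [v + d + mu c] of [d] has the right value when [mu = Q v], and it
    is reached by the shear over the identity. *)
Theorem card_orth_w13 :
  #|isoms (osum (unary (wsum w (- w))) (unary (io \o Q)))| =
  (2 ^ n * #|isoms (unary (io \o Q))|)%N.
Proof.
pose Y := [set row_mx (row2 (1 + Q v) (Q v)) v | v in [set: 'rV[F]_n]] : {set V}.
have <- : #|Y| = (2 ^ n)%N.
  by rewrite card_imset ?cardsT ?card_mx ?card_Fp ?mul1n // => u v /eq_row_mx[].
apply: card_orth_plane; first exact: twice_opp.
  move=> _ /imsetP[v _ ->]; exists id, v, (Q v); split=> // [|x].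
    exact: shear_d.
  by rewrite quad_shear wsum_shear embD // addrCA addrC wv_shear13 addrC.
move=> v mu /(wv_d13 w2) ->; exact: imset_f.
Qed.

(** The characteristic vector takes the value [w + w = 1]. The image
    [v + d + mu c] of [d] has the right value when [Q v = 0], and [mu] is free.
    The orbit has thus twice as many elements as [Q] has zeros, and
    [card_isoms_polar] turns the count into one of isometries of the polar
    form. *)
Theorem card_orth_w11 :
  #|isoms (osum (unary (wsum w w)) (unary (io \o Q)))| =
  (2 * #|isoms B|)%N.
Proof.
pose f (u : F * 'rV[F]_n) : V := row_mx (row2 (1 + u.1) u.1) u.2.
pose Y := f @: setX [set: F] (zeros Q).
rewrite card_isoms_polar // mulnA.
have <- : #|Y| = (2 * #|zeros Q|)%N.
  rewrite card_imset ?cardsX ?cardsT ?card_Fp // => -[a u] [b v].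
  by case/eq_row_mx=> /(congr1 (fun x : 'rV_2 => x 0 1)); rewrite !row2E /= => -> ->.
rewrite -(isoms_inj (unary Q) (emb_inj pr2)).
apply: card_orth_plane => //.
  move=> _ /imsetP[[mu v] + ->]; rewrite !inE /= => /eqP Qv.
  (* The shear over the identity would change [Q] by [B(., v)], as [c] is not
     singular; the transvection along the singular vector [v], which is an
     isometry of [B] only, makes up for it. *)
  pose g x := x + B x v *: v; exists g, v, mu.
  have lg : linear g.
    move=> a x y; rewrite /g (polarDl quadQ) (polarZl quadQ).
    by apply/rowP=> i; rewrite !mxE; ring.
  have [_ _ Bxx _] := sympB.
  have Qg x : Q (g x) = Q x + B x v.
    by rewrite /g (quadD Q) (quadZ quadQ) (polarZr quadQ) Qv mulr0 addr0 F2_sqr.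
  have Bg x : B (g x) v = B x v.
    by rewrite /g (polarDl quadQ) (polarZl quadQ) Bxx mulr0 addr0.
  split=> // [x y||x].
  - have [_ gD _ _] := linear_comb lg.
    by rewrite {1}/polar -gD !Qg (polarDl quadQ) /polar; ring.
  - exact: shear_d.
  - rewrite quad_shear wsum_shear Qg Bg Qv add0r -[Q _ + _ + _]addrA embD //.
    by rewrite addrCA addrC wv_shear11 addrC.
move=> v mu /wv_d11 Qv; apply/imsetP; exists (mu, v) => //.
by rewrite !inE /= Qv.
Qed.

Lemma half_neq_emb z : w <> emb z.
Proof.
move=> wz; have := w2; rewrite wz -embD // F2_addrr.
by move/(emb_inj pr2)/eqP; rewrite eq_sym oner_eq0.
Qed.

Lemma card_zeros_w :
  #|[set x : 'rV[F]_(1 + n) |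
      wv w (lsubmx x 0 0) + io (Q (rsubmx x)) == 0]| = #|zeros Q|.
Proof.
rewrite -(card_imset (zeros Q) (f := fun v => row_mx (0 : 'rV[F]_1) v)); last first.
  by move=> u v /eq_row_mx[].
congr #|pred_of_set _|; apply/setP=> x; rewrite inE.
apply/eqP/imsetP=> [|[v + ->]]; last first.
  by rewrite inE row_mxKl row_mxKr mxE wv0 add0r => /eqP->; exact: emb0.
case: (F2_cases (lsubmx x 0 0)) => x0; rewrite x0 ?wv0 ?wv1.
  rewrite add0r -(emb0 pr2) => /(emb_inj pr2) Qx.
  exists (rsubmx x); first by rewrite inE Qx.
  rewrite -[LHS]hsubmxK; congr row_mx; apply/rowP=> i.
  by rewrite ord1 x0 mxE.
by move/eqP; rewrite addr_eq0 -embN // => /eqP/half_neq_emb.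
Qed.

Lemma card_zeros_w11 :
  #|[set x : V | wsum w w (lsubmx x) + io (Q (rsubmx x)) == 0]| = (2 ^ n)%N.
Proof.
transitivity #|{: 'rV[F]_n}|; last by rewrite card_mx card_Fp // mul1n.
pose f v : V := row_mx (row2 (Q v) (Q v)) v.
rewrite -cardsT -(card_imset setT (f := f)); last by move=> u v /eq_row_mx[].
congr #|pred_of_set _|; apply/setP=> x; rewrite inE.
apply/eqP/imsetP=> [|[v _ ->]]; last first.
  rewrite row_mxKl row_mxKr /wsum !row2E.
  by case: (F2_cases (Q v)) => ->; rewrite ?wv0 ?wv1 ?w2 ?emb0 ?add0r ?emb11.
move=> x0; exists (rsubmx x) => //; move: x0; rewrite /wsum.
rewrite /f [x in _ -> x = _]rowE2; move: (rsubmx x) => v.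
case: (F2_cases (lsubmx x 0 0)) => ->; case: (F2_cases (lsubmx x 0 1)) => ->;
  rewrite ?wv0 ?wv1 ?w2 ?add0r ?addr0.
- by rewrite -(emb0 pr2) => /(emb_inj pr2) ->.
- by move/eqP; rewrite addr_eq0 -embN // => /eqP/half_neq_emb.
- by move/eqP; rewrite addr_eq0 -embN // => /eqP/half_neq_emb.
- by rewrite -embD // -(emb0 pr2) => /(emb_inj pr2)/eqP; rewrite addr_eq0 F2_oppr => /eqP <-.
Qed.

Lemma card_zeros_w13 :
  #|[set x : V | wsum w (- w) (lsubmx x) + io (Q (rsubmx x)) == 0]| =
  (2 * #|zeros Q|)%N.
Proof.
pose f (u : F * 'rV[F]_n) : V := row_mx (row2 u.1 u.1) u.2.
transitivity #|f @: setX [set: F] (zeros Q)|; last first.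
  rewrite card_imset ?cardsX ?cardsT ?card_Fp // => -[a u] [b v].
  by case/eq_row_mx=> /(congr1 (fun x : 'rV_2 => x 0 1)); rewrite !row2E /= => -> ->.
congr #|pred_of_set _|; apply/setP=> x; rewrite inE.
apply/eqP/imsetP=> [|[[a v] + ->]]; last first.
  rewrite !inE /= row_mxKl row_mxKr /wsum !row2E => /eqP->.
  by case: (F2_cases a) => ->; rewrite ?wv0 ?wv1 ?subrr emb0 ?addr0.
move=> x0; have [st Qx] : lsubmx x 0 1 = lsubmx x 0 0 /\ Q (rsubmx x) = 0.
  move: x0; rewrite /wsum; case: (F2_cases (lsubmx x 0 0)) => ->;
  case: (F2_cases (lsubmx x 0 1)) => ->; rewrite ?wv0 ?wv1 ?subrr ?add0r ?addr0.
  - by rewrite -(emb0 pr2) => /(emb_inj pr2).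
  - by rewrite addrC => /eqP; rewrite subr_eq0 eq_sym => /eqP/half_neq_emb.
  - by move/eqP; rewrite addr_eq0 -embN // => /eqP/half_neq_emb.
  - by rewrite -(emb0 pr2) => /(emb_inj pr2).
exists (lsubmx x 0 0, rsubmx x); first by rewrite !inE /= Qx.
by rewrite {1}[x]rowE2 st.
Qed.

End Forms.
End HalfIntegral.

(** * Forms with values in Q/pZ *)

Section Translation.
Variable p : nat.
Hypothesis p_pr : prime p.
Local Notation F := 'F_p.
Local Notation em := (@emb p).

Lemma Oq_isoms n (q : 'rV[F]_n -> QmodZ p) : Oq q = isoms (unary q).
Proof.
apply/setP=> f; apply/OqP/isomsP=> -[lf qf]; split=> // x.
  by move=> y; apply: qf.
exact: (qf x x).
Qed.

Lemma Ob_isoms n (b : 'rV[F]_n -> 'rV[F]_n -> QmodZ p) : Ob b = isoms b.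
Proof. by apply/setP=> f; apply/ObP/isomsP. Qed.

Lemma isometric_of_b n1 n2 (b1 : 'rV[F]_n1 -> 'rV[F]_n1 -> QmodZ p)
    (b2 : 'rV[F]_n2 -> 'rV[F]_n2 -> QmodZ p) :
  isometric_b b1 b2 -> isometric b1 b2.
Proof. by case=> f [bf fb]; exists f; split=> // a x y; rewrite linearP. Qed.

Lemma isometric_qP n1 n2 (q1 : 'rV[F]_n1 -> QmodZ p)
    (q2 : 'rV[F]_n2 -> QmodZ p) :
  isometric_q q1 q2 <-> isometric (unary q1) (unary q2).
Proof.
split=> [[f [bf fq]]|[f [lf bf fq]]].
  by exists f; split=> // [a x y|x y]; [rewrite linearP|exact: fq].
pose g : {linear 'rV[F]_n1 -> 'rV[F]_n2} :=
  HB.pack f (GRing.isLinear.Build _ _ _ _ f lf).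
by exists g; split=> // x; apply: (fq x x).
Qed.

Lemma isometric_emb n1 n2 (s1 : 'rV[F]_n1 -> 'rV[F]_n1 -> F)
    (s2 : 'rV[F]_n2 -> 'rV[F]_n2 -> F) :
  isometric s1 s2 ->
  isometric (fun x y => em (s1 x y)) (fun x y => em (s2 x y)).
Proof. by case=> f [lf bf fs]; exists f; split=> // x y; rewrite fs. Qed.

Lemma card_Oq_emb n1 n2 (q : 'rV[F]_n1 -> QmodZ p) (Q : 'rV[F]_n2 -> F) :
  isometric (unary q) (unary (em \o Q)) ->
  #|Oq q| = #|isoms (unary Q)| /\ #|zero_set q| = #|zeros Q|.
Proof.
move=> iso; rewrite Oq_isoms (card_isoms iso) (isoms_inj (unary Q) (emb_inj p_pr)).
split=> //; rewrite [LHS](card_level_isometric _ iso).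
congr #|pred_of_set _|; apply/setP=> x; rewrite !inE /=.
by rewrite -(inj_eq (emb_inj p_pr)) emb0.
Qed.

Lemma h_form_emb x : h_form x = em (hyp x).
Proof.
have [k xk] := emb_int (x 0 0); have [l xl] := emb_int (x 0 1).
by rewrite (h_formE p_pr xk xl) -rmorphM /= toQmodZ_int // rmorphM /= -xk -xl.
Qed.

Lemma multiple_h_form_emb m x : multiple_q (@h_form p) m x = em (@hyps F m x).
Proof.
elim: m x => [|m IH] x /=; first by rewrite emb0.
by rewrite /sum_q /osumq h_form_emb IH embD.
Qed.

Lemma quadratic_form_emb n (q : 'rV[F]_n -> QmodZ p) :
  quadratic_form q -> (forall x, q x *+ p = 0) ->
  exists2 Q, quadratic Q & forall x, q x = em (Q x).
Proof.
move=> [qZ [bC bD bD' nd]] qp.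
pose Q x : F := odflt 0 [pick a | q x == em a].
have qQ x : q x = em (Q x).
  rewrite /Q; case: pickP => [a /eqP //|no].
  by have [a qa] := emb_torsion p_pr (qp x); have := no a; rewrite qa eqxx.
have emZ k a : em (k%:~R * a) = em a *~ k.
  have nat_case (j : nat) : em (j%:R * a) = em a *+ j.
    elim: j => [|j IH]; first by rewrite mul0r mulr0n emb0.
    by rewrite [RHS]mulrS -IH -embD // -natr1 mulrDl mul1r addrC.
  case: k => j; first exact: nat_case.
  by rewrite NegzE mulrNz mulNr embN // nat_case mulrNz.
have polE x y : associated q x y = em (polar Q x y).
  by rewrite /associated /polar !qQ !embB.
exists Q => //; split=> [a x|x a y z|x Bx].
- have [k ->] := emb_int a; rewrite scaler_int; apply: (emb_inj p_pr).
  by rewrite -qQ qZ -rmorphXn /= emZ -qQ.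
- have D u v : polar Q x (u + v) = polar Q x u + polar Q x v.
    by apply: (emb_inj p_pr); rewrite [in RHS]embD // -!polE bD.
  have Z0 : polar Q x 0 = 0 by apply: (addrI (polar Q x 0)); rewrite -D !addr0.
  have N (j : nat) : polar Q x (y *+ j) = polar Q x y *+ j.
    by elim: j => [|j IH]; rewrite ?mulr0n // !mulrS D IH.
  by rewrite D -[a]natr_Zp scaler_nat N mulr_natl.
- apply/eqP/negPn/negP=> x0; have [y] := nd x x0.
  by rewrite polE Bx emb0 ?eqxx.
Qed.

(** [q (p x) = 0] gives [p^2 q x = 0] and [b (x, p x) = 0] gives
    [2 p q x = 0]; and [p] is a combination of [p^2] and [2 p]. *)
Lemma odd_torsion n (q : 'rV[F]_n -> QmodZ p) : p <> 2%N ->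
  quadratic_form q -> forall x, q x *+ p = 0.
Proof.
move=> p2 [qZ [bC bD bD' nd]] x.
have px : x *+ p = 0.
  by rewrite -scaler_nat pchar_Fp_0 // scale0r.
have b0 : associated q x 0 = 0.
  by apply: (addrI (associated q x 0)); rewrite -bD !addr0.
have bn (j : nat) : associated q x (x *+ j) = associated q x x *+ j.
  by elim: j => [|j IH]; rewrite ?mulr0n // !mulrS bD IH.
have q2 : q x *+ (2 * p) = 0.
  have : associated q x x *+ p = 0 by rewrite -bn px b0.
  rewrite /associated -[x + x]/(x *~ 2) qZ -addrA -opprD -mulr2n.
  rewrite -[q x *~ _]/(q x *+ 4) -mulrnBr // => <-.
  by rewrite mulrnA.
have qpp : q x *+ (p * p) = 0.
  have := qZ p%:Z x; rewrite -[x *~ _]/(x *+ p) px.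
  have -> : q 0 = 0 by have := qZ 0 0; rewrite expr2 mulr0 mulr0z mulr0z.
  by move=> /esym; rewrite -[(p%:Z ^+ 2)]/(p%:Z * p%:Z) -PoszM.
have odd_p : odd p by case: (even_prime p_pr).
have -> : q x *+ p = q x *+ (p * p) - q x *+ (2 * p) *+ p./2.
  rewrite -mulrnA -mulrnBr.
    by congr (_ *+ _); have := odd_double_half p; rewrite odd_p; nia.
  by have := odd_double_half p; rewrite odd_p; nia.
by rewrite qpp q2 mul0rn subrr.
Qed.

Lemma even_torsion n (q : 'rV[F]_n -> QmodZ p) :
  even_form q -> forall x, q x *+ 2 = 0.
Proof.
move=> [[qZ _] qe] x; have := qe x.
rewrite /associated -[x + x]/(x *~ 2) qZ -addrA -opprD -mulr2n.
by rewrite -[q x *~ _]/(q x *+ 4) -mulrnBr.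
Qed.

End Translation.

(** * The case p = 2 *)

Section TwoElementary.
Local Notation F := 'F_2.
Local Notation io := (@emb 2).
Let pr2 : prime 2 := isT.

Definition vq (x : 'rV[F]_2) : F := x 0 0 ^+ 2 + x 0 0 * x 0 1 + x 0 1 ^+ 2.

Lemma polar_vq x y : polar vq x y = x 0 0 * y 0 1 + x 0 1 * y 0 0.
Proof.
pose z := x 0 0 * y 0 0 + x 0 1 * y 0 1.
transitivity (x 0 0 * y 0 1 + x 0 1 * y 0 0 + (z + z)).
  by rewrite /polar /vq /z !mxE; ring.
by rewrite F2_addrr addr0.
Qed.

Lemma quadratic_vq : quadratic vq.
Proof.
split=> [a x|x a y z|x Bx].
- by rewrite /vq !mxE; ring.
- by rewrite !polar_vq !mxE; ring.
- apply/eqP; rewrite [x]row2_eta row2_eq0.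
  have := Bx (row2 0 1); have := Bx (row2 1 0).
  by rewrite !polar_vq !row2E !mulr0 !mulr1 addr0 add0r => -> ->; rewrite eqxx.
Qed.

Lemma anisotropic_vq : anisotropic vq.
Proof.
move=> x; rewrite [x]row2_eta /vq !row2E !expr2 !F2_sqr => /eqP.
move: (x 0 0) (x 0 1) => a b Qab; apply/eqP; rewrite row2_eq0; move: Qab.
by case: (F2_cases a) => ->; case: (F2_cases b) => ->.
Qed.

Lemma v_form_emb x : v_form x = io (vq x).
Proof.
have [k xk] := emb_int (x 0 0); have [l xl] := emb_int (x 0 1).
rewrite (v_formE xk xl) /vq xk xl -!rmorphXn -!rmorphM -!rmorphD /=.
by rewrite toQmodZ_int // !rmorphD !rmorphM !rmorphXn.
Qed.

Definition half e : QmodZ 2 := toQmodZ 2 (e%:R / 2%:R).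

Lemma w_form_wv e x : w_form e x = wv (half e) (x 0 0).
Proof.
case: (F2_cases (x 0 0)) => x0; rewrite x0.
  by rewrite (@w_formE e x 0) // expr0n mulr0 wv0 toQmodZ0.
by rewrite (@w_formE e x 1) // expr1n mulr1 wv1.
Qed.

Lemma half_half e : e = 1%N \/ e = 3%N -> half e + half e = io 1.
Proof.
move=> eE; rewrite /half -toQmodZD -mulrDl -mulr2n -[e%:R *+ 2]mulr_natr mulfK //.
rewrite -[e%:R]/((e : int)%:~R) toQmodZ_int //; congr io.
by case: eE => ->; apply: val_inj.
Qed.

Lemma half3 : half 3 = - half 1.
Proof.
apply/eqP; rewrite -addr_eq0 /half -toQmodZD -mulrDl -natrD.
rewrite (_ : (3 + 1)%:R = 2%:R * 2%:R :> rat) // mulfK //.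
rewrite -[2%:R]/((2 : int)%:~R) toQmodZ_int // -(emb0 pr2).
by apply/eqP; congr io; apply: val_inj.
Qed.

Lemma even_form_emb n (q : 'rV[F]_n -> QmodZ 2) :
  even_form q -> exists2 Q, quadratic Q & forall x, q x = io (Q x).
Proof.
move=> eq; have [qq _] := eq; apply: (quadratic_form_emb pr2 qq).
exact: even_torsion eq.
Qed.

Lemma isometric_w n (q : 'rV[F]_n -> QmodZ 2) Q e :
  (forall x, q x = io (Q x)) ->
  isometric (unary (sum_q q (w_form e)))
    (osum (unary (fun x : 'rV[F]_1 => wv (half e) (x 0 0))) (unary (io \o Q))).
Proof.
move=> qQ.
apply: isometric_trans (isometric_osumC (unary q) (unary (w_form e))) _.
by apply: isometric_ext => x y; rewrite /osum /unary /= w_form_wv qQ.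
Qed.

Lemma isometric_ww n (q : 'rV[F]_n -> QmodZ 2) Q e1 e2 :
  (forall x, q x = io (Q x)) ->
  isometric (unary (sum_q (sum_q q (w_form e1)) (w_form e2)))
    (osum (unary (wsum (half e1) (half e2))) (unary (io \o Q))).
Proof.
move=> qQ.
set w1 := unary (w_form e1); set w2 := unary (w_form e2).
apply: isometric_trans (isometric_osumA (unary q) w1 w2) _.
apply: isometric_trans (isometric_osumC (unary q) (osum w1 w2)) _.
apply: isometric_ext => x y; rewrite /osum /w1 /w2 /unary /= !w_form_wv qQ /wsum.
congr (wv _ _ + wv _ _ + _); rewrite !mxE; congr (x 0 _); exact: val_inj.
Qed.

Fixpoint hypbs m : 'rV[F]_(m * 2) -> 'rV[F]_(m * 2) -> F :=
  match m with
  | 0 => fun _ _ => 0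
  | m'.+1 => osum (@hypb F) (@hypbs m')
  end.

Lemma symplectic_hypbs m : symplectic (@hypbs m).
Proof.
elim: m => [|m IH]; last exact: (symplectic_hypb_osum IH).
by split=> [x a y z|y a x z|x|x _] /=; rewrite ?mulr0 ?addr0 //; exact: thinmx0.
Qed.

Lemma u_bar_emb x y : u_bar x y = io (hypb x y).
Proof.
rewrite /u_bar /associated /u_form !h_form_emb // -!embB //; congr io.
by rewrite -[LHS]/(polar (@hyp F) x y) polar_hyp /hypb F2_oppr.
Qed.

Lemma multiple_u_bar_emb m x y : multiple_b u_bar m x y = io (@hypbs m x y).
Proof.
elim: m x y => [|m IH] x y /=; first by rewrite emb0.
by rewrite /sum_b /osum u_bar_emb IH -embD //.
Qed.

Lemma w_bar_emb x y : w_bar x y = io (dot x y).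
Proof.
have h2 := half_half (or_introl erefl : 1%N = 1%N \/ 1%N = 3%N).
rewrite /w_bar /associated !w_form_wv (wvD_line h2) addrAC.
by rewrite [_ + _ + io _]addrC addrA addrK addrK.
Qed.

Lemma card_Ob_emb n1 n2 (b : 'rV[F]_n1 -> 'rV[F]_n1 -> QmodZ 2)
    (B : 'rV[F]_n2 -> 'rV[F]_n2 -> F) :
  isometric b (fun x y => io (B x y)) -> #|Ob b| = #|isoms B|.
Proof.
by move=> iso; rewrite Ob_isoms (card_isoms iso) (isoms_inj B (emb_inj pr2)).
Qed.

Lemma card_Ob_multiple_u_bar m : #|Ob (multiple_b u_bar m)| = #|isoms (@hypbs m)|.
Proof. by apply: card_Ob_emb; apply: isometric_ext => x y; exact: multiple_u_bar_emb. Qed.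

Theorem orders_u n (q : 'rV[F]_n -> QmodZ 2) m : (0 < m)%N ->
  isometric_q q (multiple_q u_form m) ->
  (#|Oq q| = 2 ^ (m * (m - 1) + 1) * (2 ^ m - 1)
             * \prod_(1 <= k < m) (2 ^ (2 * k) - 1)
   /\ #|zero_set q| = 2 ^ (m - 1) * (2 ^ m + 1))%N.
Proof.
move=> m0 /isometric_qP iso; pose Q0 (_ : 'rV[F]_0) : F := 0.
have q0 : quadratic Q0 by exact: quadratic0.
have a0 : anisotropic Q0 by move=> x _; exact: thinmx0.
have [|-> ->] := card_Oq_emb pr2 (q := q) (Q := osumq (@hyps F m) Q0).
  apply: isometric_trans iso _.
  apply: isometric_trans (isometric_ext (t := unary (io \o @hyps F m)) _) _.
    by move=> x y; exact: multiple_h_form_emb.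
  apply: (isometric_emb (s1 := unary (@hyps F m)) (s2 := unary (osumq (@hyps F m) Q0))).
  exact/isometric_sym/(isometric_osum0 _ (s0 := unary Q0)).
rewrite card_orth_plus // card_zeros_witt // card_Fp // zeros_plus //.
by split=> //; rewrite expnD; ring.
Qed.

Theorem orders_v n (q : 'rV[F]_n -> QmodZ 2) m : (0 < m)%N ->
  isometric_q q (sum_q (multiple_q u_form (m - 1)) v_form) ->
  (#|Oq q| = 2 ^ (m * (m - 1) + 1) * (2 ^ m + 1)
             * \prod_(1 <= k < m) (2 ^ (2 * k) - 1)
   /\ #|zero_set q| = 2 ^ (m - 1) * (2 ^ m - 1))%N.
Proof.
case: m => // m _; rewrite subn1 => /isometric_qP iso.
have [|-> ->] := card_Oq_emb pr2 (q := q) (Q := osumq (@hyps F m) vq).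
  apply: isometric_trans iso (isometric_ext _) => x y.
  by rewrite /unary /sum_q /= multiple_h_form_emb // v_form_emb -embD.
rewrite card_orth_minus ?card_zeros_witt //;
  try exact: quadratic_vq; try exact: anisotropic_vq.
rewrite card_Fp // zeros_minus.
by split=> //; rewrite expnD; ring.
Qed.

Theorem orders_w n (q : 'rV[F]_n -> QmodZ 2) n' (q' : 'rV[F]_n' -> QmodZ 2) e :
  even_form q' -> e = 1%N \/ e = 3%N -> isometric_q q (sum_q q' (w_form e)) ->
  #|Oq q| = #|Oq q'| /\ #|zero_set q| = #|zero_set q'|.
Proof.
move=> /even_form_emb[Q qQ q'E] /half_half w2 /isometric_qP iso.
have {}iso := isometric_trans iso (isometric_w e q'E).
have [|-> ->] := card_Oq_emb pr2 (q := q') (Q := Q).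
  by apply: isometric_ext => x y; exact: q'E.
rewrite Oq_isoms (card_isoms iso) (card_orth_w qQ w2).
rewrite (isoms_inj (unary Q) (emb_inj pr2)); split=> //.
rewrite -(card_zeros_w Q w2).
exact: (card_level_isometric
  (Q2 := fun x => wv _ (lsubmx x 0 0) + io (Q (rsubmx x))) 0 iso).
Qed.

Theorem orders_ww n (q : 'rV[F]_n -> QmodZ 2) n' (q' : 'rV[F]_n' -> QmodZ 2) e :
  even_form q' -> e = 1%N \/ e = 3%N ->
  isometric_q q (sum_q (sum_q q' (w_form e)) (w_form e)) ->
  (#|Oq q| = 2 * #|Ob (associated q')| /\ #|zero_set q| = 2 ^ n')%N.
Proof.
move=> /even_form_emb[Q qQ q'E] /half_half w2 /isometric_qP iso.
have {}iso := isometric_trans iso (isometric_ww e e q'E).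
rewrite (card_Ob_emb (b := associated q') (B := polar Q)); last first.
  by apply: isometric_ext => x y; rewrite /associated !q'E -!embB.
rewrite Oq_isoms (card_isoms iso) (card_orth_w11 qQ w2); split=> //.
rewrite -(card_zeros_w11 Q w2).
exact: (card_level_isometric
  (Q2 := fun x => wsum _ _ (lsubmx x) + io (Q (rsubmx x))) 0 iso).
Qed.

Theorem orders_w1w3 n (q : 'rV[F]_n -> QmodZ 2) n' (q' : 'rV[F]_n' -> QmodZ 2) :
  even_form q' ->
  isometric_q q (sum_q (sum_q q' (w_form 1)) (w_form 3)) ->
  (#|Oq q| = 2 ^ n' * #|Oq q'| /\ #|zero_set q| = 2 * #|zero_set q'|)%N.
Proof.
move=> /even_form_emb[Q qQ q'E] /isometric_qP iso.
have w2 := half_half (or_introl erefl : 1%N = 1%N \/ 1%N = 3%N).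
have := isometric_trans iso (isometric_ww 1 3 q'E); rewrite half3 => {}iso.
have [|-> ->] := card_Oq_emb pr2 (q := q') (Q := Q).
  by apply: isometric_ext => x y; exact: q'E.
rewrite Oq_isoms (card_isoms iso) (card_orth_w13 qQ w2).
rewrite (isoms_inj (unary Q) (emb_inj pr2)); split=> //.
rewrite -(card_zeros_w13 Q w2).
exact: (card_level_isometric
  (Q2 := fun x => wsum _ _ (lsubmx x) + io (Q (rsubmx x))) 0 iso).
Qed.

Theorem orders_u_bar n (b : 'rV[F]_n -> 'rV[F]_n -> QmodZ 2) m :
  isometric_b b (multiple_b u_bar m) ->
  (#|Ob b| = 2 ^ (m ^ 2) * \prod_(1 <= k < m.+1) (2 ^ (2 * k) - 1))%N.
Proof.
move=> /isometric_of_b iso; rewrite (card_Ob_emb (B := @hypbs m)); last first.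
  apply: isometric_trans iso (isometric_ext _) => x y; exact: multiple_u_bar_emb.
have [m' mm' ->] := card_symplectic (symplectic_hypbs m).
have -> : m' = m by lia.
by rewrite card_Fp.
Qed.

Theorem orders_u_bar_w n (b : 'rV[F]_n -> 'rV[F]_n -> QmodZ 2) m :
  isometric_b b (sum_b (multiple_b u_bar m) w_bar) ->
  #|Ob b| = #|Ob (multiple_b u_bar m)|.
Proof.
move=> /isometric_of_b iso.
rewrite (card_Ob_emb (B := osum (@hypbs m) (@dot 1))); last first.
  apply: isometric_trans iso (isometric_ext _) => x y.
  by rewrite /sum_b /osum multiple_u_bar_emb w_bar_emb -embD.
rewrite card_Ob_multiple_u_bar (card_isoms (isometric_osumC _ _)).
by apply: (card_isoms_line (symplectic_hypbs m)) => f /isomsP[].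
Qed.

Theorem orders_u_bar_ww n (b : 'rV[F]_n -> 'rV[F]_n -> QmodZ 2) m :
  isometric_b b (sum_b (multiple_b u_bar m) (multiple_b w_bar 2)) ->
  (#|Ob b| = 2 ^ (2 * m + 1) * #|Ob (multiple_b u_bar m)|)%N.
Proof.
move=> /isometric_of_b iso.
rewrite (card_Ob_emb (B := osum (@hypbs m) (@dot 2))); last first.
  apply: isometric_trans iso (isometric_ext _) => x y.
  rewrite /sum_b /osum multiple_u_bar_emb [in RHS]embD //; congr (_ + _).
  rewrite /= /sum_b !w_bar_emb addr0 -embD //; congr io.
  rewrite dotE2 /dot !big_ord1.
  congr (_ * _ + _ * _); rewrite !mxE; congr (_ 0 _); exact: val_inj.
rewrite card_Ob_multiple_u_bar (card_isoms (isometric_osumC _ _)).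
rewrite (card_isoms_dot2 (symplectic_hypbs m)); congr (2 ^ _ * _)%N; lia.
Qed.

End TwoElementary.

(** * The case of an odd prime *)

Section OddElementary.
Variable p : nat.
Hypotheses (p_pr : prime p) (p2 : p <> 2%N).
Local Notation F := 'F_p.

Lemma Fp_two_neq0 : 2%:R != 0 :> F.
Proof.
rewrite -(dvdn_pcharf (pchar_Fp p_pr)) dvdn_prime2 //.
exact/eqP.
Qed.

Lemma odd_witt n (q : 'rV[F]_n -> QmodZ p) : quadratic_form q ->
  exists m k (Q0 : 'rV[F]_k -> F),
    [/\ quadratic Q0, anisotropic Q0, (k <= 2)%N &
        isometric (unary q) (unary (@emb p \o osumq (@hyps F m) Q0))].
Proof.
move=> qq; have [Q qQ qE] := quadratic_form_emb p_pr qq (odd_torsion p_pr p2 qq).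
have [m [k [Q0 [q0 a0 k2 iso]]]] := witt_decomposition qQ.
exists m, k, Q0; split=> //.
apply: isometric_trans (isometric_ext (t := unary (@emb p \o Q)) _) _.
  by move=> x y; exact: qE.
exact: isometric_emb (isometric_sym iso).
Qed.

Lemma isometric_hyperbolic m (Q0 : 'rV[F]_0 -> F) : quadratic Q0 ->
  isometric (unary (@emb p \o osumq (@hyps F m) Q0))
            (unary (multiple_q (@h_form p) m)).
Proof.
move=> q0.
have iso : isometric (unary (osumq (@hyps F m) Q0)) (unary (@hyps F m)).
  by apply: (isometric_osum0 _ (s0 := unary Q0)); exact: quad0 q0.
apply: isometric_trans (isometric_emb iso) (isometric_ext _) => x y.
by rewrite /unary multiple_h_form_emb.
Qed.

Theorem orders_hyperbolic n (q : 'rV[F]_n -> QmodZ p) m :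
  hyperbolic q -> n = (2 * m)%N -> (0 < m)%N ->
  (#|Oq q| = 2 * p ^ (m * (m - 1)) * (p ^ m - 1)
             * \prod_(1 <= k < m) (p ^ (2 * k) - 1))%N.
Proof.
move=> [m' /isometric_qP iso] nm m0.
have <- : m' = m by have := isometric_dim iso; lia.
have m'0 : (0 < m')%N by have := isometric_dim iso; lia.
pose Q0 (_ : 'rV[F]_0) : F := 0.
have q0 : quadratic Q0 by exact: quadratic0.
have := isometric_trans iso (isometric_sym (isometric_hyperbolic m' q0)).
by case/(card_Oq_emb p_pr) => -> _; rewrite card_orth_plus // card_Fp.
Qed.

Theorem orders_nonhyperbolic n (q : 'rV[F]_n -> QmodZ p) m :
  quadratic_form q -> n = (2 * m)%N -> ~ hyperbolic q ->
  (#|Oq q| = 2 * p ^ (m * (m - 1)) * (p ^ m + 1)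
             * \prod_(1 <= k < m) (p ^ (2 * k) - 1))%N.
Proof.
move=> qq nm nh; have [m' [k [Q0 [q0 a0 k2 iso]]]] := odd_witt qq.
have dimn := isometric_dim iso.
case: k Q0 q0 a0 k2 iso dimn => [|[|[|]]] // Q0 q0 a0 _ iso dimn.
- case: nh; exists m'; apply/isometric_qP.
  exact: isometric_trans iso (isometric_hyperbolic m' q0).
- by lia.
- have -> : m = m'.+1 by lia.
  have [-> _] := card_Oq_emb p_pr iso.
  by rewrite card_orth_minus // card_Fp // subn1.
Qed.

Theorem orders_odd_dim n (q : 'rV[F]_n -> QmodZ p) m :
  quadratic_form q -> n = (2 * m + 1)%N ->
  (#|Oq q| = 2 * p ^ (m ^ 2) * \prod_(1 <= k < m.+1) (p ^ (2 * k) - 1))%N.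
Proof.
move=> qq nm; have [m' [k [Q0 [q0 a0 k2 iso]]]] := odd_witt qq.
have dimn := isometric_dim iso.
case: k Q0 q0 a0 k2 iso dimn => [|[|[|]]] // Q0 q0 a0 _ iso dimn; try by lia.
have -> : m = m' by lia.
have [-> _] := card_Oq_emb p_pr iso.
by rewrite card_orth_odd ?card_Fp // Fp_two_neq0.
Qed.

End OddElementary.

Local Close Scope ring_scope.

Theorem proposition2p6 :
  (* (1) *)
  (forall (n : nat) (q : 'rV['F_2]_n -> QmodZ 2), quadratic_form q ->
     (* (a) *)
     (forall m : nat, 1 <= m -> isometric_q q (multiple_q u_form m) ->
        #|Oq q| = 2 ^ (m * (m - 1) + 1) * (2 ^ m - 1)
                  * \prod_(1 <= k < m) (2 ^ (2 * k) - 1)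
        /\ #|zero_set q| = 2 ^ (m - 1) * (2 ^ m + 1))
     (* (b) *)
  /\ (forall m : nat, 1 <= m ->
        isometric_q q (sum_q (multiple_q u_form (m - 1)) v_form) ->
        #|Oq q| = 2 ^ (m * (m - 1) + 1) * (2 ^ m + 1)
                  * \prod_(1 <= k < m) (2 ^ (2 * k) - 1)
        /\ #|zero_set q| = 2 ^ (m - 1) * (2 ^ m - 1))
     (* (c) *)
  /\ (forall (n' : nat) (q' : 'rV['F_2]_n' -> QmodZ 2) (e : nat),
        even_form q' -> e = 1 \/ e = 3 ->
        isometric_q q (sum_q q' (w_form e)) ->
        #|Oq q| = #|Oq q'| /\ #|zero_set q| = #|zero_set q'|)
     (* (d) *)
  /\ (forall (n' : nat) (q' : 'rV['F_2]_n' -> QmodZ 2) (e : nat),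
        even_form q' -> e = 1 \/ e = 3 ->
        isometric_q q (sum_q (sum_q q' (w_form e)) (w_form e)) ->
        #|Oq q| = 2 * #|Ob (associated q')| /\ #|zero_set q| = 2 ^ n')
     (* (e) *)
  /\ (forall (n' : nat) (q' : 'rV['F_2]_n' -> QmodZ 2),
        even_form q' ->
        isometric_q q (sum_q (sum_q q' (w_form 1)) (w_form 3)) ->
        #|Oq q| = 2 ^ n' * #|Oq q'| /\ #|zero_set q| = 2 * #|zero_set q'|))
  (* (2) *)
/\ (forall (n : nat) (b : 'rV['F_2]_n -> 'rV['F_2]_n -> QmodZ 2) (m : nat),
      bilinear_form b ->
      (* (a) *)
      (isometric_b b (multiple_b u_bar m) ->
         #|Ob b| = 2 ^ (m ^ 2) * \prod_(1 <= k < m.+1) (2 ^ (2 * k) - 1))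
      (* (b) *)
   /\ (isometric_b b (sum_b (multiple_b u_bar m) w_bar) ->
         #|Ob b| = #|Ob (multiple_b u_bar m)|)
      (* (c) *)
   /\ (isometric_b b (sum_b (multiple_b u_bar m) (multiple_b w_bar 2)) ->
         #|Ob b| = 2 ^ (2 * m + 1) * #|Ob (multiple_b u_bar m)|))
  (* (3) *)
/\ (forall (p n : nat) (q : 'rV['F_p]_n -> QmodZ p) (m : nat),
      prime p -> p <> 2 -> quadratic_form q ->
      (* (a) *)
      (hyperbolic q -> n = 2 * m -> 1 <= m ->
         #|Oq q| = 2 * p ^ (m * (m - 1)) * (p ^ m - 1)
                   * \prod_(1 <= k < m) (p ^ (2 * k) - 1))
      (* (b) *)
   /\ (n = 2 * m -> ~ hyperbolic q ->
         #|Oq q| = 2 * p ^ (m * (m - 1)) * (p ^ m + 1)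
                   * \prod_(1 <= k < m) (p ^ (2 * k) - 1))
      (* (c) *)
   /\ (n = 2 * m + 1 ->
         #|Oq q| = 2 * p ^ (m ^ 2) * \prod_(1 <= k < m.+1) (p ^ (2 * k) - 1))).
Proof.
split; [|split].
- move=> n q _; split; [|split; [|split; [|split]]].
  + by move=> m; apply: orders_u.
  + by move=> m; apply: orders_v.
  + by move=> n' q' e; apply: orders_w.
  + by move=> n' q' e; apply: orders_ww.
  + by move=> n' q'; apply: orders_w1w3.
- move=> n b m _; split; [|split].
  + exact: orders_u_bar.
  + exact: orders_u_bar_w.
  + exact: orders_u_bar_ww.
- move=> p n q m p_pr p2 qq; split; [|split].
  + exact: orders_hyperbolic.
  + exact: orders_nonhyperbolic.
  + exact: orders_odd_dim.
Qed.
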